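(* (a) Let $G$ be any $\mathbb{Z}$-linear group. Then there exist infinitely many (pairwise non-isomorphic) right-angled Artin groups $A_\Gamma$ for which $G$ acts faithfully on $\mathrm{Out}(A_\Gamma)$ via automorphisms, i.e. for which there is an injective homomorphism $G\to \mathrm{Aut}(\mathrm{Out}(A_\Gamma))$. (b) Let $G$ be any projective $\mathbb{Z}$-linear group. Then there exist infinitely many (pairwise non-isomorphic) right-angled Artin groups $A_\Gamma$ for which $G$ acts faithfully on $\mathrm{Out}(A_\Gamma)$ via outer automorphisms, i.e. for which there is an injective homomorphism $G\to \mathrm{Out}(\mathrm{Out}(A_\Gamma))$.
   Context: For a finite simplicial graph $\Gamma$ with vertex set $V$, the right-angled Artin group $A_\Gamma$ is the group with generating set $V$ and relations $uv=vu$ for each pair of adjacent vertices $u,v$. For a group $H$, $\mathrm{Out}(H)=\mathrm{Aut}(H)/\mathrm{Inn}(H)$. A group is $\mathbb{Z}$-linear if it is isomorphic to a subgroup of $\mathrm{GL}_n(\mathbb{Z})$ for some $n\ge 1$, and projective $\mathbb{Z}$-linear if it is isomorphic to a subgroup of $\mathrm{PGL}_n(\mathbb{Z})=\mathrm{GL}_n(\mathbb{Z})/\{\pm I_n\}$ for some $n\geq 1$. *)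

(* Defs.v *)
(* Groups are the possibly infinite groups groupType of mathcomp.boot.monoid.
   The choiceType structure that a groupType carries is no restriction, since
   under the axioms of boolp every type has one. *)
From HB Require Import structures.
From mathcomp Require Import all_boot all_algebra boolp.

Set Implicit Arguments.
Unset Strict Implicit.
Unset Printing Implicit Defensive.

Import GRing.Theory.

Local Open Scope group_scope.
Local Open Scope quotient_scope.

Definition isomorphic (G H : groupType) : Prop :=
  exists f : {multiplicative G -> H}, bijective f.

Definition embeds (G H : groupType) : Prop :=
  exists f : {multiplicative G -> H}, injective f.

Definition iso_to_subgroup (G H : groupType) : Prop :=
  exists S : {pred H}, group_closed S /\
    exists2 f : {multiplicative G -> H},
      injective f & forall y, y \in S <-> exists x, f x = y.

Record normal_subgroup (G : groupType) := NormalSubgroup {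
  normal_pred :> {pred G};
  normal_closed : group_closed normal_pred;
  normalJ : forall x y, x \in normal_pred -> x ^ y \in normal_pred
}.

Section Quotient.
Variables (G : groupType) (N : normal_subgroup G).

Definition coset_rel : rel G := fun x y => x^-1 * y \in N.

Let N1 : 1 \in N := (normal_closed N).1.
Let NM : mulg_closed N := group_closedM (normal_closed N).
Let NV : invg_closed N := group_closedV (normal_closed N).

Lemma coset_rel_refl : reflexive coset_rel.
Proof. by move=> x; rewrite /coset_rel mulVg. Qed.

Lemma coset_rel_sym : symmetric coset_rel.
Proof.
by move=> x y; apply/idP/idP => /NV; rewrite invgM invgK.
Qed.

Lemma coset_rel_trans : transitive coset_rel.
Proof.
move=> y x z xy yz; have := NM xy yz.
by rewrite /coset_rel -mulgA mulVKg.
Qed.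

Definition coset_equiv :=
  EquivRel coset_rel coset_rel_refl coset_rel_sym coset_rel_trans.

Definition quot_group := {eq_quot coset_equiv}.
HB.instance Definition _ := Choice.on quot_group.

Implicit Types (x y z : G) (a b c : quot_group).

Definition quot_pi x : quot_group := \pi_{eq_quot coset_equiv} x.
Definition quot_one : quot_group := quot_pi 1.
Definition quot_mul a b : quot_group := quot_pi (repr a * repr b).
Definition quot_inv a : quot_group := quot_pi (repr a)^-1.

Lemma quot_piP x y : quot_pi x = quot_pi y <-> x^-1 * y \in N.
Proof. by split => [/eqmodP//|xy]; apply/eqmodP. Qed.

Lemma quot_repr a : quot_pi (repr a) = a.
Proof. exact: reprK. Qed.

Lemma quot_pi_surj a : exists x, quot_pi x = a.
Proof. by exists (repr a); rewrite quot_repr. Qed.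

Lemma quot_mul_pi x y : quot_mul (quot_pi x) (quot_pi y) = quot_pi (x * y).
Proof.
apply/quot_piP.
have /quot_piP xN := quot_repr (quot_pi x).
have /quot_piP yN := quot_repr (quot_pi y).
rewrite invgM.
have -> : (repr (quot_pi y))^-1 * (repr (quot_pi x))^-1 * (x * y) =
  ((repr (quot_pi y))^-1 * y) * (((repr (quot_pi x))^-1 * x) ^ y).
  by rewrite /conjg !mulgA mulgK.
by apply: NM => //; apply: normalJ.
Qed.

Lemma quot_inv_pi x : quot_inv (quot_pi x) = quot_pi x^-1.
Proof.
apply/quot_piP; rewrite invgK.
have /quot_piP/NV := quot_repr (quot_pi x).
rewrite invgM invgK => /(normalJ (x^-1)).
by rewrite /conjg invgK !mulgA mulgV mul1g.
Qed.

Lemma quot_mulA : associative quot_mul.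
Proof.
move=> a b c; rewrite -(quot_repr a) -(quot_repr b) -(quot_repr c).
by rewrite !quot_mul_pi mulgA.
Qed.

Lemma quot_mul1 : left_id quot_one quot_mul.
Proof. by move=> a; rewrite -(quot_repr a) quot_mul_pi mul1g. Qed.

Lemma quot_mulr1 : right_id quot_one quot_mul.
Proof. by move=> a; rewrite -(quot_repr a) quot_mul_pi mulg1. Qed.

Lemma quot_mulV : left_inverse quot_one quot_inv quot_mul.
Proof.
by move=> a; rewrite -(quot_repr a) quot_inv_pi quot_mul_pi mulVg.
Qed.

Lemma quot_mulrV : right_inverse quot_one quot_inv quot_mul.
Proof.
by move=> a; rewrite -(quot_repr a) quot_inv_pi quot_mul_pi mulgV.
Qed.

HB.instance Definition _ := isGroup.Build quot_group
  quot_mulA quot_mul1 quot_mulr1 quot_mulV quot_mulrV.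

HB.instance Definition _ := isMultiplicative.Build G quot_group quot_pi
  (fun x y => esym (quot_mul_pi x y)).

End Quotient.

Section Automorphisms.
Variable H : groupType.

Definition is_automorphism (f : H -> H) : Prop :=
  {morph f : x y / x * y} /\ bijective f.

Definition aut_group := {f : H -> H | `[< is_automorphism f >]}.
HB.instance Definition _ := Choice.on aut_group.

Definition aut_fun (f : aut_group) : H -> H := val f.
Coercion aut_fun : aut_group >-> Funclass.

Implicit Types f g : aut_group.

Lemma autP f : is_automorphism f.
Proof. exact/asboolP/(valP f). Qed.

Lemma aut_ext f g : f =1 g -> f = g.
Proof. by move=> fg; apply/val_inj/funext. Qed.

Definition mk_aut (f : H -> H) (fP : is_automorphism f) : aut_group :=
  exist _ f (asboolT fP).

Lemma aut_one_subproof : is_automorphism id.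
Proof. by split=> //; exists id. Qed.
Definition aut_one : aut_group := mk_aut aut_one_subproof.

Lemma aut_mul_subproof f g : is_automorphism (f \o g).
Proof.
have [[fM fb] [gM gb]] := (autP f, autP g).
by split; [move=> x y /=; rewrite gM fM | exact: bij_comp].
Qed.
(* (f * g) x = f (g x) *)
Definition aut_mul f g : aut_group := mk_aut (aut_mul_subproof f g).

Lemma aut_inv_subproof f : {g : aut_group | cancel f g /\ cancel g f}.
Proof.
apply: cid; have [fM [g fK gK]] := autP f.
have gP : is_automorphism g.
  split; last by exists f.
  by move=> x y; apply: (can_inj fK); rewrite fM !gK.
by exists (mk_aut gP).
Qed.
Definition aut_inv f : aut_group := sval (aut_inv_subproof f).

Lemma aut_invK f : cancel f (aut_inv f).
Proof. exact: (svalP (aut_inv_subproof f)).1. Qed.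

Lemma aut_invVK f : cancel (aut_inv f) f.
Proof. exact: (svalP (aut_inv_subproof f)).2. Qed.

Lemma aut_mulA : associative aut_mul.
Proof. by move=> f g h; apply: aut_ext. Qed.

Lemma aut_mul1 : left_id aut_one aut_mul.
Proof. by move=> f; apply: aut_ext. Qed.

Lemma aut_mulr1 : right_id aut_one aut_mul.
Proof. by move=> f; apply: aut_ext. Qed.

Lemma aut_mulV : left_inverse aut_one aut_inv aut_mul.
Proof. by move=> f; apply: aut_ext => x; exact: aut_invK. Qed.

Lemma aut_mulrV : right_inverse aut_one aut_inv aut_mul.
Proof. by move=> f; apply: aut_ext => x; exact: aut_invVK. Qed.

HB.instance Definition _ := isGroup.Build aut_group
  aut_mulA aut_mul1 aut_mulr1 aut_mulV aut_mulrV.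

(* x ^ a = a^-1 * x * a *)
Definition inner : {pred aut_group} :=
  fun f => `[< exists a : H, forall x, f x = x ^ a >].

Lemma innerP f : f \in inner <-> exists a : H, forall x, f x = x ^ a.
Proof. by split=> [/asboolP|?] //; apply/asboolP. Qed.

Lemma inner_closed : group_closed inner.
Proof.
split; first by apply/innerP; exists 1 => x; rewrite conjg1.
move=> /= f g /innerP[a fa] /innerP[b gb]; apply/innerP; exists (b^-1 * a) => x.
rewrite conjgM; have -> : aut_fun (f / g) x = aut_fun f (aut_inv g x) by [].
rewrite fa; congr (_ ^ a).
by rewrite -{2}(aut_invVK g x) gb conjgK.
Qed.

Lemma innerJ f g : f \in inner -> f ^ g \in inner.
Proof.
move=> /innerP[a fa]; apply/innerP; exists (aut_inv g a) => x.
have [gM _] := autP (aut_inv g); have -> : aut_fun (f ^ g) x = aut_inv g (f (g x)) by [].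
have gJ u v : aut_inv g (v * (u ^ v)) = aut_inv g u * aut_inv g v.
  by rewrite /conjg mulVKg gM.
rewrite fa; apply: (mulgI (aut_inv g a)).
by rewrite -gM gJ [aut_inv g (g x)]aut_invK /conjg mulVKg.
Qed.

Definition inn : normal_subgroup aut_group :=
  NormalSubgroup inner_closed innerJ.

Definition out_group : Type := quot_group inn.
HB.instance Definition _ := Group.on out_group.

End Automorphisms.

(* A letter (v, true) stands for the generator v, and (v, false) for v^-1. *)
Notation word V := (seq (V * bool)).

Section Presentation.
Variables (V : choiceType) (R : word V -> word V -> Prop).

(* The smallest congruence making (v, b) and (v, ~~ b) mutually inverse and
   identifying both sides of every relation of R. *)
Inductive pres_eq : word V -> word V -> Prop :=
| pres_refl w : pres_eq w w
| pres_sym w1 w2 : pres_eq w1 w2 -> pres_eq w2 w1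
| pres_trans w2 w1 w3 : pres_eq w1 w2 -> pres_eq w2 w3 -> pres_eq w1 w3
| pres_cat u1 u2 w1 w2 :
    pres_eq u1 u2 -> pres_eq w1 w2 -> pres_eq (u1 ++ w1) (u2 ++ w2)
| pres_cancel v b : pres_eq [:: (v, b); (v, ~~ b)] [::]
| pres_rel w1 w2 : R w1 w2 -> pres_eq w1 w2.

Definition pres_rel_bool : rel (word V) := fun w1 w2 => `[< pres_eq w1 w2 >].

Lemma pres_boolP w1 w2 : reflect (pres_eq w1 w2) (pres_rel_bool w1 w2).
Proof. exact: asboolP. Qed.

Lemma pres_bool_refl : reflexive pres_rel_bool.
Proof. by move=> w; apply/pres_boolP; exact: pres_refl. Qed.

Lemma pres_bool_sym : symmetric pres_rel_bool.
Proof.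
by move=> w1 w2; apply/pres_boolP/pres_boolP; exact: pres_sym.
Qed.

Lemma pres_bool_trans : transitive pres_rel_bool.
Proof.
move=> w2 w1 w3 /pres_boolP h1 /pres_boolP h2; apply/pres_boolP.
exact: pres_trans h1 h2.
Qed.

Definition pres_equiv :=
  EquivRel pres_rel_bool pres_bool_refl pres_bool_sym pres_bool_trans.

Definition pres_group := {eq_quot pres_equiv}.
HB.instance Definition _ := Choice.on pres_group.

Implicit Types (u w : word V) (a b c : pres_group).

Definition word_inv w : word V := rev [seq (l.1, ~~ l.2) | l <- w].

Definition pres_pi w : pres_group := \pi_{eq_quot pres_equiv} w.
Definition pres_gen (v : V) : pres_group := pres_pi [:: (v, true)].
Definition pres_one : pres_group := pres_pi [::].
Definition pres_mul a b : pres_group := pres_pi (repr a ++ repr b).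
Definition pres_inv a : pres_group := pres_pi (word_inv (repr a)).

Lemma pres_piP u w : pres_pi u = pres_pi w <-> pres_eq u w.
Proof.
split=> [/eqmodP/pres_boolP //|uw].
by apply/eqmodP/pres_boolP.
Qed.

Lemma pres_repr a : pres_pi (repr a) = a.
Proof. exact: reprK. Qed.

Lemma pres_mul_pi u w : pres_mul (pres_pi u) (pres_pi w) = pres_pi (u ++ w).
Proof.
by apply/pres_piP; apply: pres_cat; apply/pres_piP; rewrite pres_repr.
Qed.

Lemma word_invK : involutive word_inv.
Proof.
move=> w; rewrite /word_inv map_rev revK -map_comp -[RHS]map_id.
by apply: eq_map => -[v b] /=; rewrite negbK.
Qed.

Lemma word_mulV w : pres_eq (w ++ word_inv w) [::].
Proof.
elim: w => [|[v b] w IHw]; first exact: pres_refl.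
rewrite /word_inv /= rev_cons -cats1 catA -/(word_inv w) -cat1s.
apply: pres_trans (pres_cancel v b); rewrite -(cat1s (v, b) [:: _]).
apply: pres_cat; first exact: pres_refl.
by rewrite -[X in pres_eq _ X]cat0s; apply: pres_cat => //; exact: pres_refl.
Qed.

Lemma pres_mulA : associative pres_mul.
Proof.
move=> a b c; rewrite -(pres_repr a) -(pres_repr b) -(pres_repr c).
by rewrite !pres_mul_pi catA.
Qed.

Lemma pres_mul1 : left_id pres_one pres_mul.
Proof. by move=> a; rewrite -(pres_repr a) pres_mul_pi. Qed.

Lemma pres_mulr1 : right_id pres_one pres_mul.
Proof. by move=> a; rewrite -(pres_repr a) pres_mul_pi cats0. Qed.

Lemma pres_mulV : left_inverse pres_one pres_inv pres_mul.
Proof.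
move=> a; rewrite -{2}(pres_repr a) pres_mul_pi; apply/pres_piP.
by rewrite -{2}(word_invK (repr a)); exact: word_mulV.
Qed.

Lemma pres_mulrV : right_inverse pres_one pres_inv pres_mul.
Proof.
move=> a; rewrite -{1}(pres_repr a) pres_mul_pi.
by apply/pres_piP; exact: word_mulV.
Qed.

HB.instance Definition _ := isGroup.Build pres_group
  pres_mulA pres_mul1 pres_mulr1 pres_mulV pres_mulrV.

End Presentation.

Record sgraph := SGraph {
  vertex : finType;
  adj : rel vertex;
  adj_sym : symmetric adj;
  adj_irrefl : irreflexive adj
}.

Inductive raag_rel (Gamma : sgraph) :
    word (vertex Gamma) -> word (vertex Gamma) -> Prop :=
| RaagRel u v : adj u v ->
    raag_rel [:: (u, true); (v, true)] [:: (v, true); (u, true)].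

Definition raag (Gamma : sgraph) : Type := pres_group (@raag_rel Gamma).
HB.instance Definition _ Gamma := Group.on (raag Gamma).

Section Units.
Variable R : unitRingType.
Local Open Scope ring_scope.

Definition unit_group := {x : R | x \is a GRing.unit}.
HB.instance Definition _ := Choice.on unit_group.

Implicit Types x y : unit_group.

Definition mk_unit (x : R) (xU : x \is a GRing.unit) : unit_group :=
  exist _ x xU.

Definition unit_one : unit_group := mk_unit (unitr1 R).

Lemma unit_mul_subproof x y : val x * val y \is a GRing.unit.
Proof. by rewrite unitrMl ?(valP x) // (valP y). Qed.
Definition unit_mul x y : unit_group := mk_unit (unit_mul_subproof x y).

Lemma unit_inv_subproof x : (val x)^-1 \is a GRing.unit.
Proof. by rewrite unitrV (valP x). Qed.
Definition unit_inv x : unit_group := mk_unit (unit_inv_subproof x).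

Lemma unit_mulA : associative unit_mul.
Proof. by move=> x y z; apply: val_inj; rewrite /= mulrA. Qed.

Lemma unit_mul1 : left_id unit_one unit_mul.
Proof. by move=> x; apply: val_inj; rewrite /= mul1r. Qed.

Lemma unit_mulr1 : right_id unit_one unit_mul.
Proof. by move=> x; apply: val_inj; rewrite /= mulr1. Qed.

Lemma unit_mulV : left_inverse unit_one unit_inv unit_mul.
Proof. by move=> x; apply: val_inj; rewrite /= mulVr // (valP x). Qed.

Lemma unit_mulrV : right_inverse unit_one unit_inv unit_mul.
Proof. by move=> x; apply: val_inj; rewrite /= mulrV // (valP x). Qed.

HB.instance Definition _ := isGroup.Build unit_group
  unit_mulA unit_mul1 unit_mulr1 unit_mulV unit_mulrV.

Definition pm1 : {pred unit_group} :=
  fun x => (val x == 1) || (val x == -1).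

Lemma pm1_closed : group_closed pm1.
Proof.
split; first by rewrite unfold_in eqxx.
move=> x y; rewrite !unfold_in => x1 y1.
have -> : val (x / y)%g = val x / val y by [].
case/orP: x1 => /eqP->; case/orP: y1 => /eqP->;
  by rewrite ?invrN ?invr1 ?mulr1 ?mul1r ?mulrNN ?mulr1 ?eqxx ?orbT.
Qed.

Lemma pm1J x y : x \in pm1 -> (x ^ y)%g \in pm1.
Proof.
rewrite !unfold_in; have -> : val (x ^ y)%g = (val y)^-1 * (val x * val y) by [].
by case/orP=> /eqP->; rewrite ?mulN1r ?mulrN ?mul1r mulVr ?(valP y) ?eqxx ?orbT.
Qed.

Definition pm1_normal : normal_subgroup unit_group :=
  NormalSubgroup pm1_closed pm1J.

End Units.

(* GLZ n is GL_{n+1}(Z): square matrices form a unitRingType only in positive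
   size, which is also the range of sizes wanted. *)
Definition GLZ (n : nat) : Type := unit_group 'M[int]_n.+1.
HB.instance Definition _ n := Group.on (GLZ n).

(* PGLZ n is PGL_{n+1}(Z) = GL_{n+1}(Z) / {1, -1}. *)
Definition PGLZ (n : nat) : Type := quot_group (pm1_normal 'M[int]_n.+1).
HB.instance Definition _ n := Group.on (PGLZ n).

Definition Z_linear (G : groupType) : Prop :=
  exists n, iso_to_subgroup G (GLZ n).

Definition projective_Z_linear (G : groupType) : Prop :=
  exists n, iso_to_subgroup G (PGLZ n).

Definition infinitely_many_raags (P : sgraph -> Prop) : Prop :=
  exists Gamma : nat -> sgraph,
    (forall i j, i != j -> ~ isomorphic (raag (Gamma i)) (raag (Gamma j))) /\
    (forall i, P (Gamma i)).

(* Main.v *)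
Require Import Defs.
From HB Require Import structures.
From mathcomp Require Import all_boot all_algebra boolp.
From mathcomp Require Import zify.

Set Implicit Arguments.
Unset Strict Implicit.
Unset Printing Implicit Defensive.

Local Open Scope group_scope.

(** Both parts use the same graphs.  The graph [theta m N] consists of a vertex
    called the hub, of two ends adjacent to the hub, and of [m.+2] further paths,
    the strands, of distinct lengths, that join the two ends.  Let [A] be its
    group and [c] the generator of the hub.  The strands are the components of
    the graph minus the star of the hub, so that conjugating the strands other
    than the first by powers of [c] gives a copy of Z^(m+1) in Out(A), the group
    of shears.  The main point is that there is nothing else: every automorphism
    of [A] is, up to an inner one, a shear followed by a signed automorphism of
    the graph, and these data are unique
    ([automorphism_decomposition], [decomposition_unique]).  The graph
    automorphisms fix the hub and preserve every strand, because strands have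
    distinct lengths, so a signed automorphism acts on the shears by the sign
    with which it maps [c] ([signed_shear]).  Hence Out(A) is a semidirect
    product of Z^(m+1) by a group acting through the scalars 1 and -1, and these
    commute with GL_{m+1}(Z): every invertible matrix acts on Out(A), by acting
    on the shears and trivially on the signed part.  This action is faithful
    ([Action_inj]).  The matrix -1 acts as conjugation by the inversion of the
    hub, and a matrix that acts as an inner automorphism is 1 or -1
    ([inner_Action]), so that PGL_{m+1}(Z) embeds in Out(Out(A)).  Different
    values of [N] give different numbers of generators, hence groups that are
    not isomorphic.

    The automorphisms of [A] are computed in the Cayley graph.  For a signed
    generator [a], the elements that have a reduced word starting with [a] form
    a half space, and the predicate [starts] obeys a few simple rules from which
    everything is derived.

    First, an automorphism maps every generator to a conjugate of a generator or
    of its inverse.  Indeed a generator has two neighbours that do not commute,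
    so its image [g] commutes with two elements no powers of which commute.  A
    cyclically reduced [g] moves points along an axis, and elements commuting
    with [g] permute the walls that this axis crosses, so that suitable powers
    of them fix these walls up to powers of [g].  If two different generators
    occurred in [g], the commutators of these powers would commute with both;
    they would lie in an abelian subgroup, since two vertices have at most one
    common neighbour, and would therefore be trivial ([nonabelian_centralizer]).

    Secondly, after composition with a signed graph automorphism every generator
    [v] is mapped to a conjugate of itself, and the possible conjugators form a
    coset of the standard subgroup of the star of [v].  The cosets of adjacent
    vertices meet.  Along the cycle formed by the hub, the ends and one strand,
    removing a star leaves a path, and this forces all the cosets of the cycle
    to have a common point ([cosets_common_point]).  So the automorphism is a
    single conjugation on each of these cycles, and the conjugators of two cycles
    differ by an element that commutes with the hub and both ends, that is, by a
    power of [c]. *)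

(** * Stacks of a right-angled Artin group *)

Section Letters.
Variable Gamma : sgraph.
Local Notation V := (vertex Gamma).
Local Notation letter := (V * bool)%type.
Implicit Types (a b : letter) (x y : V).

Definition letter_inv a : letter := (a.1, ~~ a.2).

Lemma letter_invK : involutive letter_inv.
Proof. by case=> x e; rewrite /letter_inv /= negbK. Qed.

Lemma letter_inv_neq a : letter_inv a != a.
Proof. by case: a => x []; rewrite /letter_inv xpair_eqE eqxx. Qed.

Lemma adj_neq x y : adj x y -> x != y.
Proof. by apply: contraTneq => ->; rewrite adj_irrefl. Qed.

(** Stars and links are sealed: comparing two of them must not unfold the
    adjacency relation of a concrete graph. *)
Fact star_sig x : {S : {set V} | S = [set y | (y == x) || adj x y]}.
Proof. by exists [set y | (y == x) || adj x y]. Qed.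

Fact link_sig x : {S : {set V} | S = [set y | adj x y]}.
Proof. by exists [set y | adj x y]. Qed.

Definition star x : {set V} := sval (star_sig x).
Definition link x : {set V} := sval (link_sig x).

Lemma in_star x y : (y \in star x) = (y == x) || adj x y.
Proof. by rewrite /star (svalP (star_sig x)) inE. Qed.

Lemma in_link x y : (y \in link x) = adj x y.
Proof. by rewrite /link (svalP (link_sig x)) inE. Qed.

Lemma star_self x : x \in star x.
Proof. by rewrite in_star eqxx. Qed.

Lemma star_sym x y : (y \in star x) = (x \in star y).
Proof. by rewrite !in_star eq_sym adj_sym. Qed.

(** One stack for each vertex.  A generator leaves its sign on its own stack
    and a blank on the stack of every vertex that it does not commute with:
    commuting generators then write on stacks in a way that does not depend on
    the order, so that relations of the group hold on the nose. *)
Definition stacks := V -> seq (option bool).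
Implicit Type s : stacks.

Definition empty_stacks : stacks := fun=> [::].

Definition push a s : stacks := fun y =>
  if y == a.1 then Some a.2 :: s y else if adj y a.1 then s y else None :: s y.

Definition pop a s : stacks := fun y => if adj y a.1 then s y else behead (s y).

Definition on_top a s := ohead (s a.1) == Some (Some a.2).

Definition act a s := if on_top (letter_inv a) s then pop a s else push a s.

Inductive valid : stacks -> Prop :=
| valid_empty : valid empty_stacks
| valid_push a s : valid s -> ~~ on_top (letter_inv a) s -> valid (push a s).

Lemma pushK a s : pop a (push a s) = s.
Proof.
apply/funext => y; rewrite /pop /push; case: eqVneq => [->|_].
  by rewrite adj_irrefl.
by case: (adj y a.1).
Qed.

Lemma on_top_push a s : on_top a (push a s).
Proof. by rewrite /on_top /push eqxx. Qed.

Lemma act_pop a s : act a (push (letter_inv a) s) = s.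
Proof.
rewrite /act on_top_push; exact: (pushK (letter_inv a) s).
Qed.

Lemma act_push a s : ~~ on_top (letter_inv a) s -> act a s = push a s.
Proof. by rewrite /act => /negbTE->. Qed.

Lemma on_top_push_adj a b s : adj a.1 b.1 -> on_top a (push b s) = on_top a s.
Proof. by move=> ab; rewrite /on_top /push ab (negbTE (adj_neq ab)). Qed.

Lemma on_top_push_other a b s :
  on_top a (push b s) -> a = b \/ adj a.1 b.1 /\ on_top a s.
Proof.
rewrite /on_top /push; case: (eqVneq a.1 b.1) => [ab|_].
  by move=> /eqP /= [ab2]; left; case: a b ab ab2 => [? ?] [? ?] /= -> ->.
by case: (boolP (adj a.1 b.1)) => // ab ?; right.
Qed.

Lemma push_comm a b s : adj a.1 b.1 -> push a (push b s) = push b (push a s).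
Proof.
move=> ab; apply/funext => y; rewrite /push.
case: (eqVneq y a.1) => [->|ya]; first by rewrite ab (negbTE (adj_neq ab)).
case: (eqVneq y b.1) => [->|yb]; first by rewrite adj_sym ab.
by case: (adj y a.1); case: (adj y b.1).
Qed.

(** If a sign is visible, then the letters pushed later all commute with its
    letter, since any other letter would have covered it with a blank.  So it can
    be assumed to have been pushed last. *)
Lemma valid_popE a s : valid s -> on_top a s ->
  exists t, [/\ valid t, ~~ on_top (letter_inv a) t & s = push a t].
Proof.
elim=> [|b {}s vs IHs sb]; first by rewrite /on_top.
case/on_top_push_other => [->|[ab /IHs[t [vt ta st]]]]; first by exists s.
rewrite st in sb *.
exists (push b t); split; last by rewrite push_comm // adj_sym.
  by apply: valid_push => //; rewrite -(@on_top_push_adj _ a) //= adj_sym.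
by rewrite on_top_push_adj.
Qed.

Variant act_spec a s : stacks -> Prop :=
| ActPop t of s = push (letter_inv a) t & valid t & ~~ on_top a t :
    act_spec a s t
| ActPush of ~~ on_top (letter_inv a) s : act_spec a s (push a s).

Lemma actP a s : valid s -> act_spec a s (act a s).
Proof.
move=> vs; case: (boolP (on_top (letter_inv a) s)) => [sa|sa].
  have [t [vt ta st]] := valid_popE vs sa; rewrite letter_invK in ta.
  by rewrite {2}st act_pop; apply: ActPop.
by rewrite act_push //; apply: ActPush.
Qed.

Lemma valid_act a s : valid s -> valid (act a s).
Proof. by move=> vs; case: actP => // sa; apply: valid_push. Qed.

Lemma actK a s : valid s -> act a (act (letter_inv a) s) = s.
Proof.
move=> vs; case: (actP (letter_inv a) vs) => [t|_]; last exact: act_pop.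
by rewrite letter_invK => -> _ ta; rewrite act_push.
Qed.

Lemma on_top_act a s : valid s ->
  on_top a (act a s) = ~~ on_top (letter_inv a) s.
Proof.
move=> vs; case: (actP a vs) => [t -> _ /negbTE->|->].
  by rewrite on_top_push.
exact: on_top_push.
Qed.

Lemma on_top_act_adj a b s : valid s -> adj a.1 b.1 ->
  on_top a (act b s) = on_top a s.
Proof.
move=> vs ab; case: (actP b vs) => [t -> _ _|_]; by rewrite on_top_push_adj.
Qed.

Lemma on_top_compat a b s : valid s -> on_top a s -> on_top b s ->
  a = b \/ adj a.1 b.1.
Proof.
move=> vs sa sb; have [t [vt ta st]] := valid_popE vs sa.
rewrite st in sb; case/on_top_push_other: sb => [|[ba _]]; first by left.
by right; rewrite adj_sym.
Qed.

Lemma act_comm a b s : valid s -> adj a.1 b.1 ->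
  act a (act b s) = act b (act a s).
Proof.
move=> vs ab; have ba : adj b.1 a.1 by rewrite adj_sym.
case: (actP a vs) => [t st vt ta|sa]; case: (actP b vs) => [u su vu ub|sb].
- have: on_top (letter_inv b) t.
    by rewrite -(@on_top_push_adj _ (letter_inv a)) // -st su on_top_push.
  case/(valid_popE vt) => r [vr rb tr].
  have -> : u = push (letter_inv a) r.
    rewrite -(pushK (letter_inv b) u) -su st tr push_comm // pushK //.
  by rewrite tr !act_pop.
- rewrite (act_push (s := t)); first by rewrite st push_comm // act_pop.
  by apply: contra sb => tb; rewrite st on_top_push_adj.
- rewrite (act_push (s := u)); first by rewrite su -push_comm // act_pop.
  by apply: contra sa => ua; rewrite su on_top_push_adj.
by rewrite !act_push ?on_top_push_adj // push_comm.
Qed.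

End Letters.

(** * Reduced words *)

Section Words.
Variable Gamma : sgraph.
Local Notation V := (vertex Gamma).
Local Notation letter := (V * bool)%type.
Local Notation A := (raag Gamma).
Implicit Types (a b c d : letter) (x y : V) (u v w : seq letter) (g h : A).

Definition gprod w : A := pres_pi (@raag_rel Gamma) w.
Definition gen a : A := gprod [:: a].

Lemma gprod_nil : gprod [::] = 1. Proof. by []. Qed.

Lemma gprod_cat u v : gprod (u ++ v) = gprod u * gprod v.
Proof. by rewrite [RHS]pres_mul_pi. Qed.

Lemma gprod_cons a w : gprod (a :: w) = gen a * gprod w.
Proof. by rewrite -gprod_cat. Qed.

Lemma gprod_rcons w a : gprod (rcons w a) = gprod w * gen a.
Proof. by rewrite -cats1 gprod_cat. Qed.

Lemma gprod_surj g : exists w, gprod w = g.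
Proof. by exists (repr g); exact: pres_repr. Qed.

Lemma gen_inv a : gen (letter_inv a) = (gen a)^-1.
Proof.
apply/esym/mulg1_eq; rewrite -gprod_cat; apply/pres_piP.
by case: a => x e; exact: pres_cancel.
Qed.

Lemma gprod_inv w : gprod (word_inv w) = (gprod w)^-1.
Proof.
apply/esym/mulg1_eq; rewrite -gprod_cat; apply/pres_piP.
exact: word_mulV.
Qed.

Lemma gen_commute a b : adj a.1 b.1 -> commute (gen a) (gen b).
Proof.
case: a b => [x e] [y f] /= xy.
have xyt : commute (gen (x, true)) (gen (y, true)).
  by rewrite /commute -!gprod_cat; apply/pres_piP/pres_rel.
case: e f => [] []; rewrite -?[gen (_, false)]/(gen (letter_inv (_, true)))
  ?gen_inv //.
- exact: commuteV.
- by apply/commute_sym/commuteV/commute_sym.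
by apply/commuteV/commute_sym/commuteV/commute_sym.
Qed.

Lemma raag_ind (P : A -> Prop) :
  P 1 -> (forall a g, P g -> P (gen a * g)) -> forall g, P g.
Proof.
move=> P1 PM g; have [w <-] := gprod_surj g.
by elim: w => [//|a w IHw]; rewrite gprod_cons; apply: PM.
Qed.

Definition run w s := foldr (@act Gamma) s w.

Lemma valid_run w s : valid s -> valid (run w s).
Proof. by move=> vs; elim: w => //= a w; exact: valid_act. Qed.

Lemma run_pres u w s : pres_eq (@raag_rel Gamma) u w -> valid s ->
  run u s = run w s.
Proof.
move=> uw; elim: uw s => {u w} //.
- by move=> u w _ IH s vs; rewrite IH.
- by move=> w u1 u2 _ IH1 _ IH2 s vs; rewrite IH1 ?IH2.
- move=> u1 u2 w1 w2 _ IH1 _ IH2 s vs.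
  by rewrite /run !foldr_cat -!/(run _ _) IH2 // IH1 //; exact: valid_run.
- by move=> x e s vs; exact: (actK (x, e)).
by move=> w1 w2 [x y xy] s vs; exact: act_comm.
Qed.

(** The elements that start with [a] form a half space of the Cayley graph.  Its
    only properties needed below are [starts1], [starts_gen], [starts_adj] and
    [starts_compat]. *)
Definition starts a g := on_top a (run (repr g) (@empty_stacks Gamma)).

Lemma starts_gprod a w :
  starts a (gprod w) = on_top a (run w (@empty_stacks Gamma)).
Proof.
rewrite /starts; congr on_top; apply: run_pres; last exact: valid_empty.
by apply/pres_piP; exact: pres_repr.
Qed.

Lemma starts1 a : starts a 1 = false.
Proof. by rewrite -gprod_nil starts_gprod. Qed.

Lemma starts_gen a g : starts a (gen a * g) = ~~ starts (letter_inv a) g.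
Proof.
have [w <-] := gprod_surj g; rewrite -gprod_cons !starts_gprod.
by rewrite /= on_top_act //; apply/valid_run/valid_empty.
Qed.

Lemma starts_adj a b g : adj a.1 b.1 -> starts a (gen b * g) = starts a g.
Proof.
have [w <-] := gprod_surj g => ab; rewrite -gprod_cons !starts_gprod.
by rewrite /= on_top_act_adj //; apply/valid_run/valid_empty.
Qed.

Lemma starts_compat a b g : starts a g -> starts b g -> a = b \/ adj a.1 b.1.
Proof. by apply/on_top_compat/valid_run/valid_empty. Qed.

Fixpoint reduced w :=
  if w is a :: w' then ~~ starts (letter_inv a) (gprod w') && reduced w'
  else true.

Lemma starts_reduced a w : reduced (a :: w) -> starts a (gprod (a :: w)).
Proof. by case/andP=> aw _; rewrite gprod_cons starts_gen. Qed.

(** Any initial letter of an element can be brought to the front of a reduced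
    word by shuffling commuting letters. *)
Lemma exchange w b : reduced w -> starts b (gprod w) ->
  exists w', [/\ reduced (b :: w'), gprod (b :: w') = gprod w
    & perm_eq (b :: w') w].
Proof.
elim: w => [|a w IHw] rw sb; first by rewrite starts1 in sb.
have sa := starts_reduced rw.
have [<-|ab] := starts_compat sa sb; first by exists w.
have ba : adj b.1 a.1 by rewrite adj_sym.
move: sb; rewrite gprod_cons starts_adj // => sb.
have /andP[naw rw'] := rw; have [w' [rbw' ebw' pbw']] := IHw rw' sb.
have /andP[nbw' rw''] := rbw'.
exists (a :: w'); split.
- apply/and3P; split => //; first by rewrite gprod_cons starts_adj.
  by move: naw; rewrite -ebw' gprod_cons starts_adj.
- rewrite !gprod_cons -ebw' gprod_cons !mulgA; congr (_ * _).
  exact: gen_commute.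
by rewrite -(perm_cons a) in pbw'; apply: perm_trans pbw';
  rewrite (perm_catCA [:: b] [:: a] w').
Qed.

(** Reduced words of the same element differ by shuffles: this is what makes the
    length and the set of letters of an element well defined. *)
Lemma reduced_perm u w :
  reduced u -> reduced w -> gprod u = gprod w -> perm_eq u w.
Proof.
elim: u w => [|a u IHu] w ru rw uw.
  by case: w rw uw => [//|b w] /starts_reduced + uw; rewrite -uw starts1.
have sa := starts_reduced ru; rewrite uw in sa.
have [w' [raw' eaw' paw']] := exchange rw sa.
apply: perm_trans paw'; rewrite perm_cons; apply: IHu.
- by case/andP: ru.
- by case/andP: raw'.
by apply: (@mulgI _ (gen a)); rewrite -!gprod_cons uw.
Qed.

Lemma reduce w : exists u, [/\ reduced u, gprod u = gprod w,
  {subset u <= w}, size u <= size w & size u = size w -> reduced w].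
Proof.
elim: w => [|a w [u [ru uw su zu eu]]]; first by exists [::].
case: (boolP (starts (letter_inv a) (gprod u))) => sa; last first.
  exists (a :: u); split; rewrite /= ?sa ?ltnS //.
  - by rewrite !gprod_cons uw.
  - by move=> b; rewrite !inE => /orP[->//|/su->]; rewrite orbT.
  by case=> /eu->; rewrite -uw sa.
have [u' [/andP[_ ru'] eu' pu']] := exchange ru sa.
have zu' : size u = (size u').+1 by rewrite -(perm_size pu').
exists u'; split => //.
- by rewrite gprod_cons -uw -eu' gprod_cons gen_inv mulgA mulgV mul1g.
- move=> b bu'; rewrite inE; apply/orP; right; apply: su.
  by rewrite -(perm_mem pu') inE bu' orbT.
- by rewrite /=; lia.
by move=> /= ?; lia.
Qed.

Lemma exists_reduced g : exists w, reduced w /\ gprod w = g.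
Proof.
have [w <-] := gprod_surj g; have [u [ru uw _ _ _]] := reduce w.
by exists u.
Qed.

Definition len g := size (sval (cid (exists_reduced g))).

Lemma len_reduced w : reduced w -> len (gprod w) = size w.
Proof.
move=> rw; rewrite /len; case: cid => u [ru uw] /=.
exact/perm_size/reduced_perm.
Qed.

Lemma len_le w : len (gprod w) <= size w.
Proof. by have [u [ru <- _ zu _]] := reduce w; rewrite len_reduced. Qed.

Lemma reduced_len w : len (gprod w) = size w -> reduced w.
Proof.
have [u [ru uw _ _ eu]] := reduce w.
by rewrite -uw len_reduced // => /eu.
Qed.

Lemma len1 : len 1 = 0%N.
Proof. by rewrite -gprod_nil len_reduced. Qed.

Lemma size_word_inv w : size (word_inv w) = size w.
Proof. by rewrite size_rev size_map. Qed.

Lemma lenV g : len g^-1 = len g.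
Proof.
suff le h : len h^-1 <= len h by apply/eqP; rewrite eqn_leq le -{1}(invgK g) le.
have [w [rw <-]] := exists_reduced h.
by rewrite -gprod_inv (leq_trans (len_le _)) // size_word_inv len_reduced.
Qed.

Lemma reduced_inv w : reduced w -> reduced (word_inv w).
Proof.
move=> rw; apply: reduced_len.
by rewrite gprod_inv lenV len_reduced // size_word_inv.
Qed.

Lemma len_gen a g : ~~ starts (letter_inv a) g -> len (gen a * g) = (len g).+1.
Proof.
have [w [rw <-]] := exists_reduced g => sw.
by rewrite -gprod_cons !len_reduced //= sw.
Qed.

Lemma starts_len a g : starts a g -> len g = (len ((gen a)^-1 * g)).+1.
Proof.
have [w [rw <-]] := exists_reduced g => /(exchange rw)[u [ru <- _]].
by rewrite len_reduced // gprod_cons mulKg len_reduced //; case/andP: ru.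
Qed.

Lemma neq1_starts g : g != 1 -> exists a, starts a g.
Proof.
have [[|a w] [rw <-]] := exists_reduced g; first by rewrite eqxx.
by exists a; exact: starts_reduced.
Qed.

Definition ends a g := starts (letter_inv a) g^-1.

Lemma ends_len a g : ends a g -> len g = (len (g * (gen a)^-1)).+1.
Proof.
rewrite /ends => /starts_len; rewrite lenV gen_inv invgK => ->.
by rewrite -[in RHS]lenV invgM invgK.
Qed.

(** Whether [b] can be shuffled to the front of a word. *)
Fixpoint access b w :=
  if w is a :: w' then (a == b) || adj b.1 a.1 && access b w' else false.

Lemma access_cat b u v : access b (u ++ v) =
  access b u || all (fun a => adj b.1 a.1) u && access b v.
Proof.
elim: u => //= a u ->; case: (a == b) => //=.
by case: (adj _ _).
Qed.

Lemma startsE b w : reduced w -> starts b (gprod w) = access b w.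
Proof.
elim: w => [|a w IHw] rw; first exact: starts1.
have sa := starts_reduced rw; rewrite /=.
case: (eqVneq a b) => [<-//|ab] /=.
case: (boolP (adj b.1 a.1)) => ba /=.
  by rewrite gprod_cons starts_adj // IHw //; case/andP: rw.
apply/negP => sb; have [/eqP|] := starts_compat sb sa.
  by rewrite eq_sym (negbTE ab).
by rewrite (negbTE ba).
Qed.

Lemma access_mem b w : access b w -> b \in w.
Proof.
elim: w => //= a w IHw; rewrite inE eq_sym.
by case/orP=> [->//|/andP[_ /IHw->]]; rewrite orbT.
Qed.

Lemma reduced_catr u v : reduced (u ++ v) -> reduced v.
Proof. by elim: u => //= a u IHu /andP[_]. Qed.

Lemma word_inv_cat u v : word_inv (u ++ v) = word_inv v ++ word_inv u.
Proof. by rewrite /word_inv map_cat rev_cat. Qed.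

Lemma reduced_catl u v : reduced (u ++ v) -> reduced u.
Proof.
move=> /reduced_inv; rewrite word_inv_cat => /reduced_catr /reduced_inv.
by rewrite word_invK.
Qed.

Definition additive g h := len (g * h) = (len g + len h)%N.

Lemma additive_words g h : additive g h -> exists u v,
  [/\ reduced (u ++ v), gprod u = g & gprod v = h].
Proof.
have [[u [ru <-]] [v [rv <-]]] := (exists_reduced g, exists_reduced h).
rewrite /additive -gprod_cat (len_reduced ru) (len_reduced rv) -size_cat.
move/reduced_len.
by exists u, v.
Qed.

Lemma additive_reduced u v :
  reduced (u ++ v) -> additive (gprod u) (gprod v).
Proof.
move=> r; rewrite /additive -gprod_cat !len_reduced ?size_cat //.
  exact: reduced_catr r.
exact: reduced_catl r.
Qed.

Lemma additiveV g h : additive g h -> additive h^-1 g^-1.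
Proof. by rewrite /additive -invgM !lenV addnC. Qed.

Lemma starts_additive a g h : additive g h -> starts a g -> starts a (g * h).
Proof.
case/additive_words => u [v [r <- <-]].
rewrite -gprod_cat !startsE ?access_cat //; first by move->.
exact: reduced_catl r.
Qed.

Lemma ends_additive a g h : additive g h -> ends a h -> ends a (g * h).
Proof. by move=> /additiveV gh; rewrite /ends invgM; exact: starts_additive. Qed.

Lemma word_inv_mem a w : (a \in word_inv w) = (letter_inv a \in w).
Proof.
rewrite /word_inv mem_rev -[a in LHS]letter_invK.
by rewrite (mem_map (f := @letter_inv Gamma)) //; exact/can_inj/letter_invK.
Qed.

(** A cancellation in a product can only start between a last letter of the
    first factor and a first letter of the second. *)
Lemma no_cancel g h :
  (forall d, ends d g -> starts (letter_inv d) h -> False) -> additive g h.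
Proof.
have [[u [ru <-]] [v [rv <-]]] := (exists_reduced g, exists_reduced h).
move=> nc; apply: additive_reduced; elim: u ru nc => //= a u IHu /andP[au ru].
move=> nc; have auv : additive (gen a) (gprod u).
  by apply: (@additive_reduced [:: a]); rewrite /= au.
have ruv : reduced (u ++ v).
  apply: IHu => // d du; apply: (nc d).
  by rewrite gprod_cons; exact: ends_additive.
rewrite ruv andbT; apply/negP; rewrite startsE // access_cat => /orP[].
  by rewrite -startsE // (negbTE au).
case/andP=> /allP ua; rewrite -startsE //; apply: nc.
have -> : gprod (a :: u) = gprod u * gen a.
  rewrite gprod_cons; elim: u ua {IHu au ru auv ruv} => [|b u IHu] ua.
    by rewrite gprod_nil mulg1 mul1g.
  rewrite gprod_cons mulgA (gen_commute (a := a)); last first.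
    by apply: ua; rewrite inE eqxx.
  by rewrite -!mulgA IHu // => c cu; apply: ua; rewrite inE cu orbT.
rewrite /ends invgM -gen_inv starts_gen letter_invK.
apply/negP; rewrite -gprod_inv startsE; last exact: reduced_inv.
by move=> /access_mem; rewrite word_inv_mem => /ua /=; rewrite adj_irrefl.
Qed.

(** * Standard subgroups *)

(** The standard (parabolic) subgroup generated by the vertices of [X]. *)
Definition in_sub (X : {set V}) g :=
  exists w, all (fun a => a.1 \in X) w /\ gprod w = g.

Lemma in_sub1 X : in_sub X 1.
Proof. by exists [::]. Qed.

Lemma in_subM X g h : in_sub X g -> in_sub X h -> in_sub X (g * h).
Proof.
case=> [u [Xu <-]] [v [Xv <-]]; exists (u ++ v).
by rewrite all_cat Xu Xv gprod_cat.
Qed.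

Lemma in_subV X g : in_sub X g -> in_sub X g^-1.
Proof.
case=> [u [/allP Xu <-]]; exists (word_inv u); split; last exact: gprod_inv.
by apply/allP => a; rewrite word_inv_mem => /Xu.
Qed.

Lemma in_sub_gen (X : {set V}) a : a.1 \in X -> in_sub X (gen a).
Proof. by exists [:: a]; rewrite /= andbT. Qed.

Lemma in_subS (X Y : {set V}) g : X \subset Y -> in_sub X g -> in_sub Y g.
Proof.
move=> /subsetP XY [w [/allP Xw <-]]; exists w; split => //.
by apply/allP => a /Xw/XY.
Qed.

(** Reducing a word introduces no new letters, and all reduced words of an
    element have the same letters. *)
Lemma in_sub_word X w : in_sub X (gprod w) -> reduced w ->
  all (fun a => a.1 \in X) w.
Proof.
case=> [u [/allP Xu uw] rw]; have [v [rv vu sv _ _]] := reduce u.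
have /perm_mem vw : perm_eq v w by apply: reduced_perm; rewrite // vu.
by apply/allP => a; rewrite -vw => /sv/Xu.
Qed.

Lemma in_sub_starts X g a : in_sub X g -> starts a g -> a.1 \in X.
Proof.
have [w [rw <-]] := exists_reduced g => /in_sub_word/(_ rw)/allP Xw.
by rewrite startsE // => /access_mem/Xw.
Qed.

Lemma in_subI (X Y : {set V}) g : in_sub X g -> in_sub Y g -> in_sub (X :&: Y) g.
Proof.
have [w [rw <-]] := exists_reduced g => /in_sub_word/(_ rw)/allP Xw.
move=> /in_sub_word/(_ rw)/allP Yw; exists w; split => //.
by apply/allP => a aw; rewrite inE Xw ?Yw.
Qed.

Lemma commute_link a g : in_sub (link a.1) g -> commute (gen a) g.
Proof.
case=> w [+ <-]; elim: w => [|b w IHw] /=; first by move=> _; exact: commute1.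
case/andP=> ba /IHw; rewrite gprod_cons => aw; apply: commuteM => //.
by apply: gen_commute; rewrite -in_link.
Qed.

Lemma starts_gen1 a b : starts a (gen b) = (b == a).
Proof. by rewrite /gen startsE /= ?starts1 // andbF orbF. Qed.

Lemma len_gen1 a : len (gen a) = 1%N.
Proof. by rewrite /gen len_reduced //= starts1. Qed.

(** The only way to enter the half space of elements starting with [b] by an
    edge of the Cayley graph is a translate, by the standard subgroup of the
    link, of the edge from [1] to [b]. *)
Lemma entering_edge b c q : ~~ starts b q -> starts b (q * gen c) ->
  c = b /\ in_sub (link b.1) q.
Proof.
have [w [rw <-]] := exists_reduced q; elim: w rw => [|d w IHw] rw nb sb.
  move: sb; rewrite mul1g starts_gen1 => /eqP.
  by split=> //; exact: in_sub1.
have sd := starts_reduced rw.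
have sdc : starts d (gprod (d :: w) * gen c).
  apply: starts_additive sd; apply: no_cancel => e ee.
  rewrite starts_gen1 => /eqP ce.
  have/negP[] := nb; rewrite -(mulgK (gen c) (gprod (d :: w))).
  apply: starts_additive sb; rewrite /additive mulgK -gen_inv.
  rewrite (ends_len ee) -(letter_invK e) -ce gen_inv invgK.
  by rewrite lenV len_gen1 addn1.
have [bd|bd] := starts_compat sb sdc; first by rewrite bd sd in nb.
move: nb sb; rewrite gprod_cons -mulgA !starts_adj // => nb sb.
have /andP[_ rw'] := rw; have [-> iw] := IHw rw' nb sb.
by split => //; apply: in_subM => //; apply: in_sub_gen; rewrite in_link.
Qed.

Lemma sub_star_commute a g : in_sub (star a.1) g -> commute (gen a) g.
Proof.
case=> w [+ <-]; elim: w => [|b w IHw] /=; first by move=> _; exact: commute1.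
case/andP=> ba /IHw; rewrite gprod_cons => aw; apply: commuteM => //.
move: ba; rewrite in_star => /orP[/eqP ba|]; last exact: gen_commute.
case: a b ba {IHw aw} => [x e] [y f] /= ->.
have [->|/negPf fe] := eqVneq e f; first exact: commute_refl.
have -> : (x, f) = letter_inv (x, e) by rewrite /letter_inv /=; case: e f fe => [] [].
by rewrite gen_inv; apply: commuteV; exact: commute_refl.
Qed.

(** Letters of the star can be stripped off the front of [g].  If none is left
    and [g] starts with [d], then [a * g = g * a] starts both with [a] and with
    [d], so [d] is in the star after all. *)
Lemma centralizer_gen a g : commute (gen a) g -> in_sub (star a.1) g.
Proof.
have [n] := ubnP (len g); elim: n g => // n IHn g ltgn ag.
case: (pselect (exists2 d, starts d g & d.1 \in star a.1)) => [[d sd da]|nd].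
  have lg := starts_len sd.
  have -> : g = gen d * ((gen d)^-1 * g) by rewrite mulVKg.
  apply: in_subM; first exact: in_sub_gen.
  apply: IHn; first by rewrite -ltnS -lg.
  apply: commuteM => //; apply: commuteV.
  by apply: sub_star_commute; exact: in_sub_gen.
have [->|/neq1_starts[d sd]] := eqVneq g 1; first exact: in_sub1.
have nia : ~~ starts (letter_inv a) g.
  by apply/negP => sa; case: nd; exists (letter_inv a) => //=; exact: star_self.
have sag : starts a (g * gen a) by rewrite -ag starts_gen.
have sdg : starts d (g * gen a).
  apply: starts_additive sd; rewrite /additive -ag len_gen //.
  by rewrite len_gen1 addn1.
case: nd; exists d => //; rewrite in_star.
by have [->|->] := starts_compat sag sdg; rewrite ?eqxx ?orbT.
Qed.

End Words.

(** * Homomorphisms *)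

Section Morphisms.
Variables (G H : groupType) (f : G -> H).
Hypothesis fM : {morph f : x y / x * y}.

Lemma morph1 : f 1 = 1.
Proof. by apply: (@mulgI _ (f 1)); rewrite -fM !mulg1. Qed.

Lemma morphV : {morph f : x / x^-1}.
Proof. by move=> x; apply/esym/mulg1_eq; rewrite -fM mulgV morph1. Qed.

Lemma morphX n : {morph f : x / x ^+ n}.
Proof.
move=> x; elim: n => [|n IHn]; first by rewrite !expg0 morph1.
by rewrite !expgS fM IHn.
Qed.

Lemma morphJ : {morph f : x y / x ^ y}.
Proof. by move=> x y; rewrite !conjgE !fM morphV. Qed.

Lemma morphR : {morph f : x y / [~ x, y]}.
Proof. by move=> x y; rewrite !commgEl fM morphJ morphV. Qed.

Lemma morph_commute x y : commute x y -> commute (f x) (f y).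
Proof. by rewrite /commute -!fM => ->. Qed.

End Morphisms.

Section Lift.
Variables (Gamma : sgraph) (K : groupType) (f : vertex Gamma -> K).
Local Notation V := (vertex Gamma).
Local Notation letter := (V * bool)%type.
Local Notation A := (raag Gamma).

Definition lift_letter (a : letter) : K := if a.2 then f a.1 else (f a.1)^-1.
Definition lift_word (w : seq letter) : K :=
  foldr (fun a k => lift_letter a * k) 1 w.
Definition raag_lift (g : A) : K := lift_word (repr g).

Lemma lift_word_cat u w : lift_word (u ++ w) = lift_word u * lift_word w.
Proof. by elim: u => [|a u /= ->]; rewrite ?mul1g // mulgA. Qed.

Hypothesis fcomm : forall x y, adj x y -> commute (f x) (f y).

Lemma raag_lift_gprod w : raag_lift (gprod w) = lift_word w.
Proof.
rewrite /raag_lift; have /pres_piP : pres_pi (@raag_rel Gamma) (repr (gprod w)) =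
  pres_pi (@raag_rel Gamma) w by exact: pres_repr.
move: (repr _) => u; elim=> {u w} //.
- by move=> u w v _ -> _ ->.
- by move=> u1 u2 w1 w2 _ IHu _ IHw; rewrite !lift_word_cat IHu IHw.
- by move=> x [] /=; rewrite mulg1 /lift_letter /= ?mulgV ?mulVg.
by move=> _ _ [x y xy] /=; rewrite !mulg1; exact: fcomm.
Qed.

Lemma raag_liftM : {morph raag_lift : x y / x * y}.
Proof.
move=> g h; have [[u <-] [w <-]] := (gprod_surj g, gprod_surj h).
by rewrite -gprod_cat !raag_lift_gprod lift_word_cat.
Qed.

Lemma raag_lift_gen a : raag_lift (gen a) = lift_letter a.
Proof. by rewrite raag_lift_gprod /= mulg1. Qed.

End Lift.

Section RaagMorphisms.
Variables (Gamma : sgraph) (K : groupType).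
Local Notation V := (vertex Gamma).
Local Notation A := (raag Gamma).

Lemma gen_neg x : gen (x, false) = (gen (x, true))^-1 :> A.
Proof. exact: (gen_inv (x, true)). Qed.

Lemma eq_morph (f1 f2 : A -> K) :
  {morph f1 : x y / x * y} -> {morph f2 : x y / x * y} ->
  (forall x, f1 (gen (x, true)) = f2 (gen (x, true))) -> f1 =1 f2.
Proof.
move=> f1M f2M f12; elim/raag_ind => [|a g IHg]; first by rewrite !morph1.
rewrite f1M f2M IHg; congr (_ * _); case: a => x [] //.
by rewrite gen_neg (morphV f1M) (morphV f2M) f12.
Qed.

Lemma morph_abelian (f : A -> K) : {morph f : x y / x * y} ->
  (forall x y, commute (f (gen (x, true))) (f (gen (y, true)))) ->
  forall g h, commute (f g) (f h).
Proof.
move=> fM fC; have fC1 x h : commute (f (gen (x, true))) (f h).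
  elim/raag_ind: h => [|a h IHh]; first by rewrite morph1 //; exact: commute1.
  rewrite fM; apply: commuteM IHh; case: a => y []; first exact: fC.
  by rewrite gen_neg (morphV fM); apply: commuteV; exact: fC.
move=> g h; elim/raag_ind: g => [|a g IHg].
  by rewrite morph1 //; apply/commute_sym/commute1.
apply/commute_sym; rewrite fM; apply: commuteM; last exact: commute_sym.
case: a => y []; first by apply/commute_sym/fC1.
by rewrite gen_neg (morphV fM); apply/commuteV/commute_sym/fC1.
Qed.

End RaagMorphisms.

(** * Retractions and exponents *)

Section Retraction.
Variable Gamma : sgraph.
Local Notation V := (vertex Gamma).
Local Notation A := (raag Gamma).
Implicit Types (X : {set V}) (x y : V) (g h : A).

Definition retract_gen X x : A := if x \in X then gen (x, true) else 1.

Lemma retract_gen_commute X x y : adj x y ->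
  commute (retract_gen X x) (retract_gen X y).
Proof.
move=> xy; rewrite /retract_gen; case: ifP => _; case: ifP => _;
  try exact: commute1; try exact/commute_sym/commute1.
exact: gen_commute.
Qed.

Definition retract X : A -> A := raag_lift (retract_gen X).

Lemma retractM X : {morph retract X : x y / x * y}.
Proof. exact/raag_liftM/retract_gen_commute. Qed.

Lemma retract_letter X (a : V * bool) :
  retract X (gen a) = if a.1 \in X then gen a else 1.
Proof.
rewrite /retract raag_lift_gen; last exact: retract_gen_commute.
rewrite /lift_letter /retract_gen; case: a => x [] //=.
by rewrite gen_neg; case: ifP => //; rewrite invg1.
Qed.

Lemma retract_id X g : in_sub X g -> retract X g = g.
Proof.
case=> w [+ <-]; elim: w => [_|a w IHw /= /andP[aX wX]].
  by rewrite gprod_nil (morph1 (@retractM X)).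
by rewrite gprod_cons retractM IHw // retract_letter aX.
Qed.

Lemma sub_clique_abelian X g h :
  (forall x y, x \in X -> y \in X -> x != y -> adj x y) ->
  commute (retract X g) (retract X h).
Proof.
move=> cX; apply: morph_abelian; first exact: retractM.
move=> x y; rewrite !retract_letter /=; case: ifP => xX; case: ifP => yX;
  try exact: commute1; try exact/commute_sym/commute1.
have [->|xy] := eqVneq x y; first exact: commute_refl.
by apply: gen_commute; exact: cX.
Qed.

Local Open Scope ring_scope.
Import GRing.Theory.

Definition letter_expo x (a : V * bool) : int :=
  if a.1 == x then (if a.2 then 1 else -1) else 0.
Definition expo x g : int := \sum_(a <- repr g) letter_expo x a.

Lemma expo_gprod x w : expo x (gprod w) = \sum_(a <- w) letter_expo x a.
Proof.
rewrite /expo; have /pres_piP : pres_pi (@raag_rel Gamma) (repr (gprod w)) =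
  pres_pi (@raag_rel Gamma) w by exact: pres_repr.
move: (repr _) => u; elim=> {u w} //.
- by move=> u w v _ -> _ ->.
- by move=> u1 u2 w1 w2 _ IHu _ IHw; rewrite !big_cat /= IHu IHw.
- move=> y e; rewrite big_cons big_seq1 big_nil /letter_expo /=.
  by case: (y == x); case: e.
by move=> _ _ [y z yz]; rewrite !big_cons !big_nil !addr0 addrC.
Qed.

Lemma expoM x g h : expo x (g * h)%g = expo x g + expo x h.
Proof.
have [[u <-] [w <-]] := (gprod_surj g, gprod_surj h).
by rewrite -gprod_cat !expo_gprod big_cat.
Qed.

Lemma expo1 x : expo x 1%g = 0.
Proof. by rewrite -gprod_nil expo_gprod big_nil. Qed.

Lemma expoV x g : expo x g^-1%g = - expo x g.
Proof. by apply/eqP; rewrite -addr_eq0 -expoM mulVg expo1. Qed.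

Lemma expoJ x g h : expo x (g ^ h)%g = expo x g.
Proof. by rewrite conjgE !expoM expoV; lia. Qed.

Lemma expoX x g n : expo x (g ^+ n)%g = n%:Z * expo x g.
Proof.
elim: n => [|n IHn]; first by rewrite expg0 expo1 mul0r.
by rewrite expgS expoM IHn; lia.
Qed.

Lemma expo_gen x a : expo x (gen a) = letter_expo x a.
Proof. by rewrite expo_gprod big_seq1. Qed.

End Retraction.

(** * Elements with a non-abelian centralizer *)

Section Centralizers.
Variable Gamma : sgraph.
Local Notation V := (vertex Gamma).
Local Notation letter := (V * bool)%type.
Local Notation A := (raag Gamma).
Implicit Types (a b c : letter) (g h z : A).

Lemma additive_starts b g h : additive g h -> starts b (g * h) ->
  starts b g \/ in_sub (link b.1) g /\ starts b h.
Proof.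
case/additive_words=> u [v [r <- <-]]; rewrite -gprod_cat startsE //.
rewrite access_cat -!startsE; last exact: reduced_catl r.
  case/orP=> [|/andP[bu bv]]; [by left|right; split => //].
  by exists u; split=> //; apply: sub_all bu => a; rewrite in_link.
exact: reduced_catr r.
Qed.

Lemma starts_additive_gen b g : starts b g -> additive (gen b) ((gen b)^-1 * g).
Proof. by move=> bg; rewrite /additive mulVKg len_gen1 (starts_len bg). Qed.

Definition cyclically_minimal g := forall h, len g <= len (g ^ h).

Lemma exists_cyclically_minimal g : exists h, cyclically_minimal (g ^ h).
Proof.
have ex : exists n, `[< exists h, len (g ^ h) = n >].
  by exists (len (g ^ 1)); apply/asboolP; exists 1.
case: (ex_minnP ex) => n /asboolP[h <-] hmin; exists h => k.
by apply: hmin; apply/asboolP; exists (h * k); rewrite conjgM.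
Qed.

Lemma cyclically_minimalV g : cyclically_minimal g -> cyclically_minimal g^-1.
Proof. by move=> gmin h; rewrite conjVg !lenV. Qed.

(** If [g] started with [b] and ended with its inverse, then conjugating it by
    [b] would make it shorter. *)
Lemma cyclically_minimal_starts b g : cyclically_minimal g ->
  starts b g -> ~~ starts b g^-1.
Proof.
move=> gmin bg; apply/negP => bgV.
have := additiveV (starts_additive_gen bg).
set h := (gen b)^-1 * g => /additive_starts-/(_ b).
rewrite -invgM mulVKg => /(_ bgV)[bh|[_]]; last first.
  by rewrite -gen_inv starts_gen1 (negbTE (letter_inv_neq b)).
have := gmin (gen b); rewrite conjgE mulgA -/h (starts_len bg) -/h.
by rewrite -[len h]lenV -[len (h * _)]lenV (starts_len bh) -invgM ltnNge leqW.
Qed.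

Section Axis.
Variables (g : A) (b : letter).
Hypotheses (gmin : cyclically_minimal g) (bg : starts b g).

(** There is no cancellation between the successive factors of a power: the
    powers of [g] run along a geodesic. *)
Lemma additive_power n :
  additive g (g ^+ n) /\ forall d, starts d (g ^+ n) -> starts d g.
Proof.
elim: n => [|n [gn IHn]].
  by rewrite expg0 /additive mulg1 len1 addn0; split=> // d; rewrite starts1.
have st d : starts d (g ^+ n.+1) -> starts d g.
  by rewrite expgS => /(additive_starts gn)[//|[_ /IHn]].
split=> //; apply: no_cancel => e; rewrite /ends => eg /st.
by apply/negP; apply: contraL eg; exact: cyclically_minimal_starts.
Qed.

Lemma starts_power n : starts b (g ^+ n.+1).
Proof. by rewrite expgS; apply: starts_additive bg; case: (additive_power n). Qed.

End Axis.

Lemma starts_powerV g b n : cyclically_minimal g -> starts b g ->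
  ~~ starts b (g ^- n).
Proof.
move=> gmin bg; rewrite -expVgn; apply/negP.
case: (additive_power (cyclically_minimalV gmin) n) => _ st /st.
by apply/negP; exact: cyclically_minimal_starts.
Qed.

(** The sequence of the [g ^+ n * h] stays at a bounded distance from the axis of
    [g], so it has the same ends relative to the half space of [b].  By induction
    on [h]: the translates by powers of [g] of one edge of the Cayley graph can
    cross the wall of [b] only once in each direction, because by [entering_edge]
    two crossings would differ by an element of the link subgroup, while they
    differ by a power of [g], which starts with [b]. *)
Lemma starts_power_mul g b h : cyclically_minimal g -> starts b g ->
  exists N, forall n, N <= n ->
    starts b (g ^+ n * h) /\ ~~ starts b (g ^- n * h).
Proof.
move=> gmin bg.
have nlink n : ~ in_sub (link b.1) (g ^+ n.+1).
  move=> /in_sub_starts/(_ (starts_power gmin bg n)).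
  by rewrite in_link adj_irrefl.
have nlink2 k m n : in_sub (link b.1) (g ^+ m * k) ->
    in_sub (link b.1) (g ^+ n * k) -> m = n.
  wlog: m n / m <= n => [wl mk nk|mn /in_subV mk nk].
    by have [/wl->//|/ltnW/wl->] := leqP m n.
  apply/eqP; rewrite eqn_leq mn leqNgt; apply/negP => mltn.
  have := in_subM nk mk; rewrite invgM mulgA mulgK -expgnFr //.
  by rewrite -(prednK (n := n - m)) ?subn_gt0 //; exact: nlink.
have nlink2V k m n : in_sub (link b.1) (g ^- m * k) ->
    in_sub (link b.1) (g ^- n * k) -> m = n.
  wlog: m n / n <= m => [wl mk nk|mn mk /in_subV nk].
    by have [/wl->//|/ltnW/wl->] := leqP n m.
  apply/eqP; rewrite eqn_leq mn andbT leqNgt; apply/negP => mltn.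
  have E : (g ^- m * k) * (g ^- n * k)^-1 = g ^- m * g ^+ n.
    by rewrite invgM mulgA mulgK invgK.
  have := in_subV (in_subM mk nk); rewrite E invgM invgK -(subnKC mn) expgnDr.
  rewrite mulKg.
  by rewrite -(prednK (n := m - n)) ?subn_gt0 //; exact: nlink.
have [w <-] := gprod_surj h; elim/last_ind: w => [|w c [N IHN]].
  exists 1%N => -[//|n] _; rewrite !mulg1; split; first exact: starts_power.
  exact: starts_powerV.
rewrite gprod_rcons.
have ev (P : nat -> Prop) : (forall m n, P m -> P n -> m = n) ->
    exists M, forall n, M <= n -> ~ P n.
  move=> uP; case: (pselect (exists n, P n)) => [[n Pn]|nP]; last first.
    by exists 0%N => n _ Pn; apply: nP; exists n.
  by exists n.+1 => m nm /uP/(_ Pn) mn; rewrite mn ltnn in nm.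
have [M1 HM1] := ev _ (nlink2 (gprod w * gen c)).
have [M2 HM2] := ev _ (nlink2V (gprod w)).
exists (N + M1 + M2)%N => n Hn; have [|bn bnV] := IHN n; first by lia.
split; [apply/negPn/negP => nsb|apply/negP => sb].
  have ub : starts b (g ^+ n * (gprod w * gen c) * gen (letter_inv c)).
    by rewrite gen_inv mulgA mulgK.
  have [_] := entering_edge nsb ub.
  by apply: HM1; lia.
rewrite mulgA in sb; have [_] := entering_edge bnV sb.
by apply: HM2; lia.
Qed.

End Centralizers.

Lemma discrete_ivt (f : nat -> bool) n : ~~ f 0%N -> f n ->
  exists2 m, m < n & ~~ f m && f m.+1.
Proof.
elim: n => [|n IHn] f0 fn; first by rewrite fn in f0.
case: (boolP (f n)) => [/(IHn f0)[m mn fm]|nfn].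
  by exists m => //; exact: ltnW.
by exists n; rewrite ?nfn.
Qed.

Lemma commgMl_central (G : groupType) (x y u : G) :
  commute u x -> commute u y -> [~ x * u, y] = [~ x, y].
Proof.
move=> ux uy; rewrite !commgEl conjMg; have -> : u ^ y = u.
  by rewrite conjgE uy mulKg.
rewrite invgM -!mulgA; apply: (@mulgI _ u); rewrite mulVKg.
have xu : commute u (x^-1 * x ^ y).
  by rewrite conjgE; do ?[apply: commuteM|apply: commuteV].
by rewrite [RHS]xu conjgE -!mulgA.
Qed.

Section Centralizers.
Variable Gamma : sgraph.
Local Notation V := (vertex Gamma).
Local Notation letter := (V * bool)%type.
Local Notation A := (raag Gamma).
Implicit Types (a b c : letter) (g h z : A).

Lemma commg_in_sub (X : {set V}) g h :
  in_sub X g -> in_sub X h -> in_sub X [~ g, h].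
Proof.
move=> Xg Xh; rewrite commgEl conjgE.
by do ![apply: in_subM => //]; exact: in_subV.
Qed.

(** These are the corrections, in practice powers of [g], that disappear from
    commutators of elements commuting with [g]. *)
Definition bicentral g z := forall k, commute k g -> commute k z.

(** The path from [h * g ^- N] to [h * g ^+ N] along the translate by [h] of the
    axis has to enter the half space of [b], and it does so at an edge labelled
    by some letter of [w]. *)
Lemma axis_edge g b w h : cyclically_minimal g -> starts b g -> gprod w = g ->
  commute h g -> exists2 i, i < size w &
    exists2 z, bicentral g z & in_sub (link b.1) (h * z * gprod (take i w)).
Proof.
move=> gmin bg wg hg; have [N HN] := starts_power_mul h gmin bg.
have [bN bNV] := HN _ (leqnn N).
have [||m _ /andP[nm sm]] :=
    @discrete_ivt (fun m => starts b (g ^- N * g ^+ m * h)) (N + N).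
- by rewrite expg0 mulg1.
- by rewrite expgnDr mulKg.
pose z := g ^- N * g ^+ m.
have zC : bicentral g z.
  by move=> k kg; apply: commuteM; [apply/commuteV/commuteX|exact: commuteX].
have hz : g ^- N * g ^+ m * h = h * z by rewrite (zC h hg).
have hzg : g ^- N * g ^+ m.+1 * h = h * z * g.
  by rewrite expgSr -hz -!mulgA; congr (_ * (_ * _)); exact/esym.
rewrite hz in nm; rewrite hzg in sm.
have [||i iw /andP[ni si]] :=
    @discrete_ivt (fun i => starts b (h * z * gprod (take i w))) (size w).
- by rewrite take0 gprod_nil mulg1.
- by rewrite take_size wg.
exists i => //; exists z => //.
rewrite (take_nth b iw) gprod_rcons mulgA in si.
by case: (entering_edge ni si).
Qed.

(** An element [h] that commutes with [g] permutes the walls that cross the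
    axis of [g].  These form finitely many orbits under [g], so by the pigeonhole
    principle some power of [h] moves the wall of [b] as a power of [g] does, and
    the stabilizer of this wall is the link subgroup. *)
Lemma power_in_link g b h : cyclically_minimal g -> starts b g ->
  commute h g -> exists r z,
    [/\ 0 < r, bicentral g z & in_sub (link b.1) (h ^+ r * z)].
Proof.
move=> gmin bg hg; have [w [rw wg]] := exists_reduced g.
have hXg s : commute (h ^+ s) g by apply/commute_sym/commuteX/commute_sym.
have /choice[F HF] : forall s : 'I_(size w).+1, exists i : 'I_(size w),
    exists2 z, bicentral g z &
      in_sub (link b.1) (h ^+ s * z * gprod (take i w)).
  move=> s; have [i iw Hi] := axis_edge gmin bg wg (hXg s).
  by exists (Ordinal iw).
have [s [t [st Fst]]] : exists s t : 'I_(size w).+1, s < t /\ F s = F t.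
  apply: contrapT => nF.
  suff /leq_card : injective F by rewrite !card_ord ltnn.
  move=> s t Fst; apply: val_inj.
  by case: (ltngtP s t) => // lt; case: nF; [exists s, t|exists t, s].
have [[z1 z1C Hs] [z2 z2C Ht]] := (HF s, HF t); rewrite Fst in Hs.
exists (t - s)%N, (z2 * z1^-1); split; first by rewrite subn_gt0.
  move=> k kg; apply: commuteM; first exact: z2C.
  by apply: commuteV; exact: z1C.
have := in_subM Ht (in_subV Hs); congr in_sub.
rewrite invgM mulgA mulgK invgM mulgA expgnFr ?(ltnW st) // -!mulgA.
congr (_ * _); rewrite mulgA; apply/esym.
have : commute (h ^+ s)^-1 (z2 * z1^-1).
  apply/commute_sym/commuteV/commute_sym.
  by apply: commuteM; [apply: z2C|apply/commuteV/z1C]; exact: hXg.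
done.
Qed.

(** The corrections of [power_in_link] drop out of the commutator.  The factor
    [q] allows the same exponent to be used for two different letters. *)
Lemma commg_in_link g b h k : cyclically_minimal g -> starts b g ->
  commute h g -> commute k g -> exists2 r, 0 < r &
    forall q, 0 < q -> in_sub (link b.1) [~ h ^+ (r * q), k ^+ (r * q)].
Proof.
move=> gmin bg hg kg.
have [r1 [z1 [r1gt z1C L1]]] := power_in_link gmin bg hg.
have [r2 [z2 [r2gt z2C L2]]] := power_in_link gmin bg kg.
exists (r1 * r2)%N => [|q _]; first by rewrite muln_gt0 r1gt.
have L m g' : in_sub (link b.1) g' -> in_sub (link b.1) (g' ^+ m).
  move=> Lg; elim: m => [|m IHm]; first by rewrite expg0; exact: in_sub1.
  by rewrite expgS; exact: in_subM.
have hz m z : bicentral g z -> (h ^+ r1 * z) ^+ m = h ^+ (r1 * m) * z ^+ m.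
  move=> zC; rewrite expgMn -?expgnA //.
  by apply/commute_sym/commuteX/commute_sym/zC.
have kz m z : bicentral g z -> (k ^+ r2 * z) ^+ m = k ^+ (r2 * m) * z ^+ m.
  move=> zC; rewrite expgMn -?expgnA //.
  by apply/commute_sym/commuteX/commute_sym/zC.
have := L (r2 * q)%N _ L1; rewrite hz // => {}L1.
have := L (r1 * q)%N _ L2; rewrite kz // => {}L2.
have -> : (r1 * r2 * q = r1 * (r2 * q))%N by rewrite mulnA.
have E : (r1 * (r2 * q) = r2 * (r1 * q))%N by rewrite mulnCA.
rewrite -E in L2; set R := (r1 * (r2 * q))%N in L1 L2 *.
set u1 := z1 ^+ _ in L1; set u2 := z2 ^+ _ in L2.
have u1C : bicentral g u1 by move=> x xg; apply: commuteX; exact: z1C.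
have u2C : bicentral g u2 by move=> x xg; apply: commuteX; exact: z2C.
have hR : commute (h ^+ R) g by apply/commute_sym/commuteX/commute_sym.
have kR : commute (k ^+ R) g by apply/commute_sym/commuteX/commute_sym.
have u1g : commute u1 g by apply/commute_sym/u1C.
have u2g : commute u2 g by apply/commute_sym/u2C.
have -> : [~ h ^+ R, k ^+ R] = [~ h ^+ R * u1, k ^+ R * u2].
  rewrite commgMl_central; first last.
  - by apply: commuteM; [apply/commute_sym/u1C|exact: u2C].
  - exact/commute_sym/u1C.
  rewrite -[RHS]invgR commgMl_central ?invgR //.
    exact/commute_sym/u2C.
  exact/commute_sym/u2C.
exact: commg_in_sub.
Qed.

End Centralizers.

Section Elliptic.
Variable Gamma : sgraph.
Local Notation V := (vertex Gamma).
Local Notation letter := (V * bool)%type.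
Local Notation A := (raag Gamma).
Implicit Types (a b c : letter) (g h z : A).

Definition clique_links := forall x y u v : V, x != y ->
  u \in link x :&: link y -> v \in link x :&: link y -> u != v -> adj u v.

Lemma gprod_nseq n b : gprod (nseq n b) = gen b ^+ n.
Proof. by elim: n => //= n IHn; rewrite gprod_cons IHn expgS. Qed.

Lemma reduced_first_letters b w : reduced (b :: w) ->
  (exists n, b :: w = nseq n.+1 b) \/
  exists j c v, c.1 != b.1 /\ b :: w = nseq j.+1 b ++ c :: v.
Proof.
elim: w => [|c w IHw]; first by left; exists 0%N.
move=> /=/andP[bc rcw].
have [cb|cb] := eqVneq c.1 b.1; last by right; exists 0%N, c, w.
have ec : c = b.
  apply: contraTeq bc => ncb; rewrite negbK.
  have -> : letter_inv b = c.
    case: c b cb ncb {IHw rcw} => [x e] [y f] /= ->.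
    by rewrite xpair_eqE eqxx /letter_inv /=; case: e f => [] [].
  exact: starts_reduced.
case: IHw => [|[n [E]]|[j [d [v [db [E]]]]]]; first by rewrite -ec.
  by left; exists n.+1; rewrite ec /= E.
by right; exists j.+1, d, v; rewrite ec /= E.
Qed.

Lemma cyclically_minimalJ g h : cyclically_minimal g -> len (g ^ h) = len g ->
  cyclically_minimal (g ^ h).
Proof. by move=> gmin gh k; rewrite gh -conjgM. Qed.

(** If [g] is not a power of its first letter [b], let [c] be the first letter of
    [g] with another vertex, and rotate [g] so that it starts with [c].  The
    commutators produced by [commg_in_link] lie in the links of both [b] and [c].
    The intersection of these links is a clique, so the commutators lie in an
    abelian retract, where they are trivial. *)
Lemma nonabelian_centralizer g h k : clique_links ->
  cyclically_minimal g -> commute h g -> commute k g ->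
  (forall r, 0 < r -> [~ h ^+ r, k ^+ r] <> 1) ->
  g = 1 \/ exists b n, g = gen b ^+ n.+1.
Proof.
move=> cl gmin hg kg nc; have [w [rw wg]] := exists_reduced g.
case: w rw wg => [|b w] rw wg; first by left.
right; case: (reduced_first_letters rw) => [[n E]|[j [c [v [cb E]]]]].
  by exists b, n; rewrite -wg E gprod_nseq.
have bg : starts b g by rewrite -wg; exact: starts_reduced.
have [r1 r1gt L1] := commg_in_link gmin bg hg kg.
pose p := gen b ^+ j.+1.
have gp : g ^ p = gprod (c :: v ++ nseq j.+1 b).
  rewrite -wg E gprod_cat gprod_nseq -/p conjgE -mulgA mulKg.
  by rewrite /p -gprod_nseq -gprod_cat.
have zgp : len (g ^ p) = len g.
  apply/eqP; rewrite eqn_leq gmin andbT gp (leq_trans (len_le _)) //.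
  by rewrite -wg len_reduced // E !size_cat /= size_cat /= addnC !addSn addnS.
have gpmin := cyclically_minimalJ gmin zgp.
have cgp : starts c (g ^ p).
  rewrite gp; apply/starts_reduced/reduced_len.
  rewrite -gp zgp -wg len_reduced // E !size_cat /= size_cat /= addnC.
  by rewrite !addSn addnS.
have CJ x : commute x g -> commute (x ^ p) (g ^ p).
  by rewrite /commute -!conjMg => ->.
have [r2 r2gt L2] := commg_in_link gpmin cgp (CJ h hg) (CJ k kg).
have := L1 r2 r2gt; have := L2 r1 r1gt; rewrite [(r2 * r1)%N]mulnC.
have := nc (r1 * r2)%N; rewrite muln_gt0 r1gt r2gt => /(_ isT).
rewrite -!conjXg -conjRg; set hk := [~ _, _] => hk1 Lc Lb.
have hkp : hk ^ p = hk.
  rewrite conjgE (_ : hk * p = p * hk) ?mulKg //.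
  apply: commuteX; exact/commute_sym/commute_link.
rewrite hkp in Lc; case: hk1; rewrite -(retract_id (in_subI Lb Lc)).
rewrite /hk (morphR (@retractM _ _)); apply/eqP/commgP.
by apply: sub_clique_abelian => x y; apply: cl; rewrite eq_sym.
Qed.

Lemma starts_powerM a h n : ~~ starts (letter_inv a) h ->
  starts a (gen a ^+ n.+1 * h).
Proof.
move=> ah; elim: n => [|n IHn]; first by rewrite expg1 starts_gen.
rewrite expgS -mulgA starts_gen; apply/negP => /(starts_compat IHn)[/eqP|].
  by rewrite eq_sym (negbTE (letter_inv_neq a)).
by rewrite adj_irrefl.
Qed.

Lemma commg_powers a b n : ~~ adj a.1 b.1 -> a.1 != b.1 ->
  [~ gen a ^+ n.+1, gen b ^+ n.+1] <> 1.
Proof.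
have sb c : starts c (gen c ^+ n.+1).
  by rewrite -[_ ^+ _]mulg1 starts_powerM // starts1.
have nf c d : ~~ adj c.1 d.1 -> c.1 != d.1 ->
    starts c (gen c ^+ n.+1 * gen d ^+ n.+1).
  move=> cd cd1; apply: starts_powerM; apply/negP => /(starts_compat (sb d)).
  by case=> [dc|]; [rewrite dc eqxx in cd1|rewrite adj_sym (negbTE cd)].
move=> ab ab1 /eqP/commgP E; have := nf a b ab ab1; rewrite E => sa.
have := nf b a; rewrite adj_sym ab eq_sym ab1 => /(_ isT isT).
case/(starts_compat sa) => [ba|]; last by rewrite (negbTE ab).
by rewrite ba eqxx in ab1.
Qed.

Lemma gen_neq1 a : gen a <> 1.
Proof. by move=> a1; have := starts_gen1 a a; rewrite eqxx a1 starts1. Qed.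

(** Retract to the star of [a]: a conjugate of [b] that commutes with [a] lies
    in the star subgroup, and would be killed if [b] were outside of it. *)
Lemma commute_conj_gen a b g h : commute (gen a ^ g) (gen b ^ h) ->
  a.1 != b.1 -> adj a.1 b.1.
Proof.
move=> ab nab.
have : commute (gen a) (gen b ^ (h * g^-1)).
  by rewrite /commute -{1 2}(conjgK g (gen a)) conjgM -!conjMg ab.
move/centralizer_gen; set k := h * g^-1 => sk.
have : b.1 \in star a.1.
  apply: contra_notT (@gen_neq1 b) => nb; apply: (@conjg_inj _ k).
  rewrite conj1g -(retract_id sk) (morphJ (@retractM _ _)) retract_letter.
  by rewrite (negbTE nb) conj1g.
by rewrite in_star eq_sym (negbTE nab).
Qed.

End Elliptic.

(** * Isomorphisms *)

Definition branching Gamma := forall x : vertex Gamma,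
  exists y z, [/\ adj x y, adj x z, y != z & ~~ adj y z].

Section InjectiveMorphism.
Variables (Gamma Gamma' : sgraph) (f : raag Gamma -> raag Gamma').
Hypotheses (fM : {morph f : x y / x * y}) (fI : injective f).
Hypotheses (br : branching Gamma) (cl : clique_links Gamma').

Lemma image_gen x : exists b n k, f (gen (x, true)) = (gen b ^+ n.+1) ^ k.
Proof.
have [y [z [xy xz yz nyz]]] := br x.
have [k kmin] := exists_cyclically_minimal (f (gen (x, true))).
have CJ u : adj x u ->
    commute (f (gen (u, true)) ^ k) (f (gen (x, true)) ^ k).
  move=> xu; rewrite /commute -!conjMg -!fM.
  by rewrite [_ * gen (x, true)]gen_commute // adj_sym.
have [r rgt|k1|[b [n E]]] := nonabelian_centralizer cl kmin (CJ y xy) (CJ z xz).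
- rewrite -!conjXg -conjRg => /eqP; rewrite conjg_eq1 => /eqP.
  rewrite -!(morphX fM) -(morphR fM) -(morph1 fM) => /fI.
  by case: r rgt => // r _; exact: commg_powers.
- have /(@conjg_inj _ k) : f (gen (x, true)) ^ k = 1 ^ k by rewrite k1 conj1g.
  by rewrite -(morph1 fM) => /fI/gen_neq1.
by exists b, n, k^-1; rewrite -E conjgK.
Qed.

End InjectiveMorphism.

Definition good Gamma := branching Gamma /\ clique_links Gamma.

Section Isomorphism.
Variables (Gamma Gamma' : sgraph).
Variables (f : raag Gamma -> raag Gamma') (f' : raag Gamma' -> raag Gamma).
Hypotheses (fM : {morph f : x y / x * y}) (fM' : {morph f' : x y / x * y}).
Hypotheses (fK : cancel f f') (fK' : cancel f' f).
Hypotheses (gd : good Gamma) (gd' : good Gamma').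

(** The exponents found by [image_gen] for [f] and for its inverse have product
    1, as the exponent sums of [f' (f x)] show. *)
Lemma iso_gen x : exists a k, f (gen (x, true)) = gen a ^ k /\
  exists e k', f' (gen (a.1, true)) = gen (x, e) ^ k'.
Proof.
have [b [n [k fx]]] := image_gen fM (can_inj fK) gd.1 gd'.2 x.
have [c [m [l fb]]] := image_gen fM' (can_inj fK') gd'.1 gd.2 b.1.
have : expo x (f' (f (gen (x, true)))) = 1%R.
  by rewrite fK expo_gen /letter_expo /= eqxx.
have fb2 : expo x (f' (gen b)) =
    ((if b.2 then 1 else -1) * (Posz m.+1 * letter_expo x c))%R.
  case: b fb {fx} => y [] /= E; first by rewrite E expoJ expoX expo_gen; lia.
  by rewrite gen_neg (morphV fM') E expoV expoJ expoX expo_gen; lia.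
rewrite fx (morphJ fM') (morphX fM') expoJ expoX fb2 /letter_expo.
case: (eqVneq c.1 x) => cx; last by lia.
move=> E; have [n0 m0] : n = 0%N /\ m = 0%N by case: (b.2) (c.2) E => [] [] E; nia.
exists b, k; split; first by rewrite n0 expg1.
by exists c.2, l; rewrite fb m0 expg1 -cx; case: (c).
Qed.

End Isomorphism.

Lemma conj_gen_inj (Gamma : sgraph) (a b : vertex Gamma * bool) g h :
  gen a ^ g = gen b ^ h -> a = b.
Proof.
move=> /(congr1 (expo a.1)); rewrite !expoJ !expo_gen /letter_expo eqxx.
case: a b => [x []] [y []] /=; case: eqVneq => [->|] //; lia.
Qed.

Section VertexBijection.
Variables (Gamma Gamma' : sgraph).
Variables (f : raag Gamma -> raag Gamma') (f' : raag Gamma' -> raag Gamma).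
Hypotheses (fM : {morph f : x y / x * y}) (fM' : {morph f' : x y / x * y}).
Hypotheses (fK : cancel f f') (fK' : cancel f' f).
Hypotheses (gd : good Gamma) (gd' : good Gamma').

Lemma iso_vertices : exists (a : vertex Gamma -> vertex Gamma' * bool) k s',
  [/\ forall x, f (gen (x, true)) = gen (a x) ^ k x,
      cancel (fun x => (a x).1) s', cancel s' (fun x => (a x).1)
    & forall x y, adj (a x).1 (a y).1 = adj x y].
Proof.
have /choice[a /choice[k Ha]] := iso_gen fM fM' fK fK' gd gd'.
have /choice[a' /choice[k' Ha']] := iso_gen fM' fM fK' fK gd' gd.
pose s x := (a x).1; pose s' x := (a' x).1.
have sK : cancel s s'.
  move=> x; have [_ [e [l E]]] := Ha x.
  by have [+ _] := Ha' (s x); rewrite E /s' => /conj_gen_inj <-.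
have sK' : cancel s' s.
  move=> x; have [_ [e [l E]]] := Ha' x.
  by have [+ _] := Ha (s' x); rewrite E /s => /conj_gen_inj <-.
have adjs x y : adj x y -> adj (s x) (s y).
  move=> xy; apply: (@commute_conj_gen _ (a x) (a y) (k x) (k y)).
    rewrite -(Ha x).1 -(Ha y).1; apply: (morph_commute fM).
    exact: gen_commute.
  by rewrite (inj_eq (can_inj sK)) adj_neq.
have adjs' x y : adj x y -> adj (s' x) (s' y).
  move=> xy; apply: (@commute_conj_gen _ (a' x) (a' y) (k' x) (k' y)).
    rewrite -(Ha' x).1 -(Ha' y).1; apply: (morph_commute fM').
    exact: gen_commute.
  by rewrite (inj_eq (can_inj sK')) adj_neq.
exists a, k, s'; split => //; first by move=> x; case: (Ha x).
move=> x y; apply/idP/idP; last exact: adjs.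
by move/adjs'; rewrite -!/(s _) !sK.
Qed.

End VertexBijection.

Lemma raag_iso_card Gamma Gamma' : good Gamma -> good Gamma' ->
  isomorphic (raag Gamma) (raag Gamma') -> #|vertex Gamma| = #|vertex Gamma'|.
Proof.
move=> gd gd' [f [f' fK fK']]; have fM : {morph f : x y / x * y} by exact: gmulfM.
have fM' : {morph f' : x y / x * y}.
  by move=> x y; apply: (can_inj fK); rewrite fM !fK'.
have [a [k [s' [_ sK sK' _]]]] := iso_vertices fM fM' fK fK' gd gd'.
by apply: bij_eq_card; exists s'; [exact: sK|exact: sK'].
Qed.

(** * Common points of cosets of stars *)

Section Cosets.
Variable Gamma : sgraph.
Local Notation V := (vertex Gamma).
Local Notation letter := (V * bool)%type.
Local Notation A := (raag Gamma).
Implicit Types (a b c d : letter) (x y z u v : V) (g h s t : A).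

(** A coset of a standard subgroup crosses the walls labelled by its own letters
    only. *)
Lemma starts_mulr_sub (X : {set V}) c h s :
  c.1 \notin X -> in_sub X s -> starts c (h * s) = starts c h.
Proof.
move=> cX [w [+ <-]]; elim/last_ind: w => [|w b IHw]; first by rewrite mulg1.
rewrite all_rcons => /andP[bX /IHw {}IHw]; rewrite gprod_rcons mulgA -IHw.
have bc : b <> c by move=> bc; rewrite bc (negbTE cX) in bX.
apply/idP/idP => sc; apply/negPn/negP => nc.
  by have [] := entering_edge nc sc.
have sc' : starts c (h * gprod w * gen b * gen (letter_inv b)).
  by rewrite gen_inv mulgK.
have [E _] := entering_edge nc sc'.
by have := congr1 fst E; move=> /= E1; rewrite E1 (negbTE cX) in bX.
Qed.

(** Strip letters of the star of [a] off the front of [u] and letters of the star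
    of [b] off its end.  When this is no longer possible, [u * b * u^-1] has no
    cancellation, so a first letter of [u] would be one of its first letters. *)
Lemma star_product a b (u : A) : in_sub (star a.1) (u * gen b * u^-1) ->
  exists s s', [/\ in_sub (star a.1) s, in_sub (star b.1) s' & u = s * s'].
Proof.
have [n] := ubnP (len u); elim: n u => // n IHn u ltun ub.
case: (pselect (exists2 d, starts d u & d.1 \in star a.1)) => [[d du da]|nd].
  have [||s [s' [sa sb E]]] := IHn ((gen d)^-1 * u).
  - by rewrite -ltnS -(starts_len du).
  - rewrite invgM invgK -!mulgA; apply: in_subM.
      by rewrite -gen_inv; exact: in_sub_gen.
    by rewrite !mulgA; apply: in_subM => //; exact: in_sub_gen.
  exists (gen d * s), s'; split => //; last by rewrite -mulgA -E mulVKg.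
  by apply: in_subM => //; exact: in_sub_gen.
case: (pselect (exists2 d, ends d u & d.1 \in star b.1)) => [[d du db]|ne].
  have [||s [s' [sa sb E]]] := IHn (u * (gen d)^-1).
  - by rewrite -ltnS -(ends_len du).
  - rewrite invgM invgK; have dbC : commute (gen b) (gen d).
      by apply: sub_star_commute; exact: in_sub_gen.
    by rewrite -!mulgA [gen b * _]mulgA dbC -mulgA mulKg mulgA.
  exists s, (s' * gen d); split => //; last by rewrite mulgA -E mulgVK.
  by apply: in_subM => //; exact: in_sub_gen.
have [->|/neq1_starts[d du]] := eqVneq u 1.
  by exists 1, 1; rewrite mulg1; split=> //; exact: in_sub1.
have addb : additive u (gen b).
  apply: no_cancel => e eu; rewrite starts_gen1 => /eqP be; apply: ne.
  by exists e => //; rewrite be; exact: star_self.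
have addu : additive (u * gen b) u^-1.
  apply: no_cancel => e eub eu; case: ne; exists e; first by rewrite /ends.
  have addV := additiveV addb; move: eub; rewrite /ends invgM.
  case/(additive_starts addV) => [|[+ _]].
    rewrite -gen_inv starts_gen1 => /eqP/(congr1 fst) /= <-.
    exact: star_self.
  rewrite -gen_inv => /(@in_sub_starts _ _ _ (letter_inv b)).
  rewrite starts_gen1 eqxx in_link /= => /(_ isT) eb.
  by rewrite in_star adj_sym eb orbT.
case: nd; exists d => //; apply: (in_sub_starts ub).
exact/(starts_additive addu)/(starts_additive addb).
Qed.

(** If the conjugates [a ^ g] and [b ^ h] commute then the cosets formed by the
    elements conjugating them to [a] and to [b] have a common point. *)
Lemma commuting_cosets_meet a b g h : commute (gen a ^ g) (gen b ^ h) ->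
  exists t, in_sub (star a.1) (g * t) /\ in_sub (star b.1) (h * t).
Proof.
move=> ab; have : commute (gen a) (gen b ^ (h * g^-1)).
  by rewrite /commute -{1 2}(conjgK g (gen a)) conjgM -!conjMg ab.
move/centralizer_gen; rewrite conjgE mulgA -{2}(invgK (h * g^-1)).
case/star_product => s [s' [sa sb E]]; exists (g^-1 * s).
split; first by rewrite mulVKg.
have <- : s'^-1 = h * (g^-1 * s); last exact: in_subV.
by rewrite mulgA -[h * g^-1]invgK E invgM mulgVK.
Qed.

Section Helly.
Variables (C : {set V}) (k : V -> A).

Definition in_coset v t := in_sub (star v) (k v * t).

Hypothesis meet : forall u v, u \in C -> v \in C -> adj u v ->
  exists t, in_coset u t /\ in_coset v t.
(* connectedness of [C :\: star z], by transport of predicates along edges *)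
Hypothesis conn : forall z (B : V -> Prop),
  (forall u v, u \in C :\: star z -> v \in C :\: star z -> adj u v ->
     B u -> B v) ->
  forall u v, u \in C :\: star z -> v \in C :\: star z -> B u -> B v.
Hypothesis two : forall z, 1 < #|C :\: star z|.
Hypothesis escape : forall z v, v \in C -> v \in star z -> v != z ->
  exists u, [/\ u \in C, adj v u & u \notin star z].

(** Choose a base point [g] and points [g * q v] of the cosets with minimal total
    distance to [g].  Suppose that [q u] starts with [b].  If [u] is outside the
    star of [b.1], then so does [q v] for all the [v] of [C] outside this star, by
    connectedness, while the cosets of vertices in the star cross the wall of [b]
    or lie behind it, except perhaps that of [b.1] itself: moving the base point
    across this wall decreases the total distance.  So every [q u] can only start with the
    letters of [u] itself.  If [q v] is nontrivial, the first letter [c] of [q v]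
    with another vertex gives a wall behind the wall of [v], and all the cosets
    of vertices outside the star of [c.1] are behind it; at least one of them
    belongs to a vertex other than [v], and then it starts with a letter of [v],
    which is a contradiction. *)
Lemma cosets_common_point : exists t, forall v, v \in C -> in_coset v t.
Proof.
pose family (p : A * (V -> A)) := forall v, v \in C -> in_coset v (p.1 * p.2 v).
pose total (p : A * (V -> A)) := \sum_(v in C) len (p.2 v).
have fam0 : exists n, `[< exists2 p, family p & total p = n >].
  exists (total (1, fun v => (k v)^-1)); apply/asboolP.
  exists (1, fun v => (k v)^-1) => // v _.
  by rewrite /in_coset /= mul1g mulgV; exact: in_sub1.
case: (ex_minnP fam0) => n /asboolP[[g q] /= famq <-] qmin {fam0}.
have {}qmin p : family p -> total (g, q) <= total p.
  by move=> famp; apply: qmin; apply/asboolP; exists p.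
pose K v t := in_sub (star v) (k v * g * t).
have Kq v : v \in C -> K v (q v) by move/famq; rewrite /K /in_coset mulgA.
have Kmul v t s : in_sub (star v) s -> K v t -> K v (t * s).
  by rewrite /K mulgA => sv tv; exact: in_subM.
have Kdiff v t t' : K v t -> K v t' -> in_sub (star v) (t^-1 * t').
  move=> /in_subV tv t'v; have := in_subM tv t'v.
  by rewrite invgM -mulgA mulKg.
have meetK u v : u \in C -> v \in C -> adj u v -> exists t, K u t /\ K v t.
  move=> uC vC /(meet uC vC)[t [tu tv]]; exists (g^-1 * t).
  by rewrite /K -!mulgA mulVKg.
have qends v d : v \in C -> d.1 \in star v -> ~ ends d (q v).
  move=> vC dv dq; pose q' u := if u == v then q v * (gen d)^-1 else q u.
  have /qmin : family (g, q').
    move=> u uC; rewrite /in_coset /= mulgA; apply: (_ : K u (q' u)).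
    rewrite /q'; case: eqVneq => [->|_]; last exact: Kq.
    by apply: Kmul; [rewrite -gen_inv; exact: in_sub_gen|exact: Kq].
  apply/negP; rewrite -ltnNge /total /= (bigD1 v) //= [ltnRHS](bigD1 v) //=.
  rewrite /q' eqxx (ends_len dq) addSn ltnS leq_add2l.
  by apply: leq_sum => u /andP[_ /negbTE->].
have qadd v s : v \in C -> in_sub (star v) s -> additive (q v) s.
  move=> vC sv; apply: no_cancel => d dq /(in_sub_starts sv) /= dv.
  exact: qends dq.
have qstarts b v t : v \in C -> starts b (q v) -> K v t -> starts b t.
  move=> vC bq tv; rewrite -(mulVKg (q v) t); apply: starts_additive bq.
  by apply: qadd => //; apply: Kdiff => //; exact: Kq.
have outside b v t t' : v \in C -> b.1 \notin star v -> K v t -> K v t' ->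
    starts b t -> starts b t'.
  move=> vC bv tv t'v; rewrite -[in starts b t'](mulVKg t t').
  by rewrite (starts_mulr_sub _ bv) //; exact: Kdiff.
have qpropagate b u v : u \in C -> v \in C -> adj u v -> b.1 \notin star v ->
    starts b (q u) -> starts b (q v).
  move=> uC vC uv bv bu; have [t [tu tv]] := meetK u v uC vC uv.
  by apply: (outside b v t) => //; [exact: Kq|exact: (qstarts b u)].
have inR z v : (v \in C :\: star z) = (v \in C) && (z \notin star v).
  by rewrite inE andbC star_sym.
have noR b u : u \in C :\: star b.1 -> starts b (q u) -> False.
  move=> uR bu; have allR v : v \in C :\: star b.1 -> starts b (q v).
    move=> vR; move: uR vR bu.
    apply: (@conn b.1 (fun y => starts b (q y))) => x y; rewrite !inR.
    by move=> /andP[xC _] /andP[yC yb] xy; exact: qpropagate.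
  (* the new points, seen from the base point moved by [b]: cosets that cross
     the wall of [b] keep their distance if their point is moved along *)
  pose q' v := if starts b (q v) || (v == b.1) then (gen b)^-1 * q v
               else (gen b)^-1 * (q v * gen b).
  have star_or v : v \in C -> ~~ starts b (q v) -> v \in star b.1.
    by move=> vC; apply: contraNT => vb; apply: allR; rewrite inE vb.
  have /qmin : family (g * gen b, q').
    move=> v vC; rewrite /in_coset /= /q'.
    case: ifPn => [_|/norP[bv _]]; rewrite -mulgA mulVKg mulgA.
      exact: Kq.
    apply: Kmul; last exact: Kq.
    by apply: in_sub_gen; rewrite star_sym; exact: star_or.
  have le v : v \in C -> len (q' v) + (v \in C :\: star b.1) <=
      len (q v) + (v == b.1).
    move=> vC; rewrite /q'; case: (boolP (starts b (q v))) => [bv|bv] /=.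
      by rewrite (starts_len bv) addSn -addnS leq_add2l; case: (v \in _).
    have vb := star_or v vC bv; rewrite inE vb /= addn0.
    case: eqVneq => [_|nvb] /=.
      by rewrite addn1 -gen_inv len_gen // letter_invK.
    rewrite addn0; have [w [wC vw wb]] := escape vC vb nvb.
    have [t [tv tw]] := meetK v w vC wC vw.
    have bt : starts b t.
      by apply: (qstarts b w) tw => //; apply: allR; rewrite inE wb.
    have := bt; rewrite -(mulVKg (q v) t) => /additive_starts[||[qv _]].
    - by apply: qadd => //; apply: Kdiff => //; exact: Kq.
    - by rewrite (negbTE bv).
    by rewrite -(commute_link qv) mulKg.
  move=> le1.
  have : \sum_(v in C) (len (q' v) + (v \in C :\: star b.1)) <=
    \sum_(v in C) (len (q v) + (v == b.1)) by apply: leq_sum.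
  rewrite !big_split /= => le2.
  have s1 : \sum_(v in C) (v == b.1) <= 1.
    rewrite big_mkcond /= (bigD1 b.1) //= big1 ?addn0 ?eqxx; last first.
      by move=> v /negbTE->; case: ifP.
    by case: ifP.
  have s2 : 1 < \sum_(v in C) (v \in C :\: star b.1).
    apply: leq_trans (two b.1) _; rewrite -sum1_card big_mkcond /=.
    rewrite [leqRHS]big_mkcond /=; apply: leq_sum => v _.
    by rewrite in_setD; case: (v \in C); case: (v \in star b.1).
  by move: le1 le2; rewrite {1 2}/total /=; lia.
have onlyz b u : u \in C -> starts b (q u) -> u = b.1.
  move=> uC bu; apply: contraPeq bu => ub bu.
  case: (boolP (u \in star b.1)) => usb; last first.
    by apply: noR bu; rewrite inE usb.
  have [w [wC uw wb]] := escape uC usb ub.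
  apply: (noR b w); first by rewrite inE wb.
  by apply: (qpropagate b u) => //; rewrite star_sym.
suff q1 v : v \in C -> q v = 1.
  by exists g => v vC; have := famq v vC; rewrite /= q1 // mulg1.
move=> vC; apply: contrapT => /eqP/neq1_starts[b bv].
have vb := onlyz b v vC bv.
have [w0 [rw0 wq0]] := exists_reduced (q v).
have [w [rw wq _]] : exists w, [/\ reduced (b :: w), gprod (b :: w) = q v
    & perm_eq (b :: w) w0] by rewrite -wq0; apply: exchange; rewrite ?wq0.
have [[j E]|[j [c [w' [cb E]]]]] := reduced_first_letters rw.
  apply: (qends v b vC); first by rewrite vb; exact: star_self.
  rewrite -wq E gprod_nseq expgSr; apply: ends_additive.
    rewrite -gprod_nseq; apply: additive_reduced.
    by rewrite -[[:: b]]/(nseq 1 b) -nseqD addn1 -E.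
  by rewrite /ends -gen_inv starts_gen1.
have cv : (c.1 == v) = false by rewrite vb; exact/negbTE.
have cq : c.1 \notin star v.
  rewrite in_star cv /=.
  apply/negP => vc; have : starts c (q v).
    rewrite -wq startsE // E access_cat; apply/orP; right; apply/andP.
    split; last by rewrite /= eqxx.
    by apply/allP => d; rewrite mem_nseq => /andP[_ /eqP->]; rewrite -vb adj_sym.
  by move/(onlyz c v vC)/eqP; rewrite eq_sym cv.
pose p := gen b ^+ j.+1.
have qp : q v = p * gprod (c :: w') by rewrite -wq E gprod_cat gprod_nseq.
(* the coset of [u] is behind the translate by [p] of the wall of [c] *)
pose B u := forall t, K u t -> starts c (p^-1 * t).
have vR : v \in C :\: star c.1 by rewrite inR vC.
have Bv : B v.
  move=> t tv; rewrite -(mulVKg (q v) t) qp -mulgA mulKg.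
  apply: starts_additive; last first.
    by apply: starts_reduced; move: rw; rewrite E => /reduced_catr.
  apply: no_cancel => d dw /in_sub_starts ds.
  apply: (qends v d vC).
    by apply: ds; rewrite -qp; apply: Kdiff => //; exact: Kq.
  rewrite qp; apply: ends_additive dw; rewrite /p -gprod_nseq.
  by apply: additive_reduced; rewrite -E.
have [u [uR uv]] : exists u, u \in C :\: star c.1 /\ u != v.
  apply: contrapT => nu; have := two c.1; apply/negP; rewrite -leqNgt.
  rewrite -(cards1 v); apply/subset_leq_card/subsetP => u uR; rewrite inE.
  by apply: contrapT => /negP uv; apply: nu; exists u.
have : B u.
  move: vR uR Bv; apply: (@conn c.1 B) => x y; rewrite !inR.
  move=> /andP[xC _] /andP[yC yc] xy Bx t ty.
  have [t' [tx' ty']] := meetK x y xC yC xy.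
  have -> : p^-1 * t = (p^-1 * t') * (t'^-1 * t) by rewrite -mulgA mulVKg.
  by rewrite (starts_mulr_sub _ yc (Kdiff _ _ _ ty' ty)); exact: Bx.
move: uR; rewrite inR => /andP[uC _] Bu.
have : starts b (q u).
  rewrite -(mulVKg p (q u)); apply: starts_powerM; apply/negP => nb.
  have [bc|] := starts_compat nb (Bu _ (Kq u uC)).
    by rewrite -bc /= eqxx in cb.
  by move=> bc; rewrite in_star vb [adj b.1 _]bc orbT in cq.
by move/(onlyz b u uC); rewrite -vb => uv'; rewrite uv' eqxx in uv.
Qed.

End Helly.

End Cosets.

(** * Theta graphs *)

Section Theta.
Variables (m N : nat).

(** Vertices are encoded by coordinates, a strand and a rank.  The pairs (0, 0),
    (0, 1) and (0, 2) are the hub and the two ends; for [0 < a] the pairs (a, j)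
    with [j <= N + a] are the successive vertices of a strand, the first one being
    adjacent to (0, 1) and the last one to (0, 2). *)
Definition theta_ok (a j : nat) : bool :=
  (a <= m.+2) && (if a == 0%N then j <= 2 else j <= N + a).

Definition theta_vertex :=
  {u : 'I_(m.+3) * 'I_(N + m + 3) | theta_ok u.1 u.2}.

Section Vertices.
Implicit Types u v w x y z : theta_vertex.

Definition strand u : nat := (val u).1.
Definition rank u : nat := (val u).2.

Lemma theta_okP u : theta_ok (strand u) (rank u).
Proof. exact: valP u. Qed.

Lemma theta_ex a j : theta_ok a j -> exists u, strand u = a /\ rank u = j.
Proof.
move=> ok; have am : a < m.+3 by case/andP: ok.
have jK : j < N + m + 3 by case/andP: ok => _; case: ifP => _; lia.
have ok' : theta_ok (Ordinal am, Ordinal jK).1 (Ordinal am, Ordinal jK).2 by [].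
by exists (exist _ (Ordinal am, Ordinal jK) ok').
Qed.

(** Half of the adjacency relation: hub to end, end to strand, and one step along
    a strand. *)
Definition theta_arc (a j a' j' : nat) : bool :=
  [|| [&& a == 0, a' == 0, j == 0 & 0 < j'],
      [&& a == 0, 0 < a', 0 < j & j' == if j == 1 then 0 else N + a']
    | [&& 0 < a, a == a' & j.+1 == j']]%N.

Definition theta_adjn (a j a' j' : nat) : bool :=
  theta_arc a j a' j' || theta_arc a' j' a j.

Definition theta_adj : rel theta_vertex :=
  fun u v => theta_adjn (strand u) (rank u) (strand v) (rank v).

Lemma theta_adj_sym : symmetric theta_adj.
Proof. by move=> u v; rewrite /theta_adj /theta_adjn orbC. Qed.

Lemma theta_arc_irrefl a j : theta_arc a j a j = false.
Proof. by rewrite /theta_arc; lia. Qed.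

Lemma theta_adj_irrefl : irreflexive theta_adj.
Proof. by move=> u; rewrite /theta_adj /theta_adjn theta_arc_irrefl. Qed.

End Vertices.

Definition theta := SGraph theta_adj_sym theta_adj_irrefl.

Local Notation T := (vertex theta).
Implicit Types u v w x y z : T.

Lemma theta_eqP u v : (u == v) = (strand u == strand v) && (rank u == rank v).
Proof. by []. Qed.

Lemma theta_adjE u v : adj u v =
  theta_adjn (strand u) (rank u) (strand v) (rank v).
Proof. by []. Qed.

Lemma theta_inj u v : strand u = strand v -> rank u = rank v -> u = v.
Proof. by move=> E1 E2; apply/eqP; rewrite theta_eqP E1 E2 !eqxx. Qed.

Lemma theta_branching : branching theta.
Proof.
move=> x; have ok := theta_okP x.
have mk a j a' j' : theta_ok a j -> theta_ok a' j' ->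
    theta_adjn (strand x) (rank x) a j -> theta_adjn (strand x) (rank x) a' j' ->
    (a, j) != (a', j') -> ~~ theta_adjn a j a' j' ->
    exists y z, [/\ adj x y, adj x z, y != z & ~~ adj y z].
  move=> /theta_ex[y [<- <-]] /theta_ex[z [<- <-]] xy xz yz nyz.
  by exists y, z; split.
have [x0|x0] := eqVneq (strand x) 0%N.
  have [q0|q0] := eqVneq (rank x) 0%N.
    by apply: (mk 0 1 0 2)%N; rewrite ?x0 ?q0.
  have [q1|q1] := eqVneq (rank x) 1%N.
    by apply: (mk 0 0 1 0)%N; rewrite ?x0 ?q1.
  have q2 : rank x = 2%N by move: ok; rewrite x0 /theta_ok /=; lia.
  by apply: (mk 0 0 1 (N + 1))%N; rewrite ?x0 ?q2 /theta_ok /theta_adjn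
    /theta_arc //=; lia.
have {x0} x0 : 0 < strand x by lia.
move: ok mk; rewrite /theta_ok (gtn_eqF x0) => /andP[xm xN] mk.
have [q0|q0] := eqVneq (rank x) 0%N.
  by apply: (mk 0 1 (strand x) 1)%N; rewrite ?q0 /theta_ok /theta_adjn /theta_arc
    ?(gtn_eqF x0) /= ?xpair_eqE; lia.
have [qN|qN] := eqVneq (rank x) (N + strand x)%N.
  by apply: (mk 0 2 (strand x) (rank x).-1)%N; rewrite /theta_ok /theta_adjn /theta_arc
    ?(gtn_eqF x0) /= ?xpair_eqE; lia.
by apply: (mk (strand x) (rank x).-1 (strand x) (rank x).+1)%N;
  rewrite /theta_ok /theta_adjn /theta_arc ?(gtn_eqF x0) /= ?xpair_eqE; lia.
Qed.

Variant arc_spec (a j a' j' : nat) : Prop :=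
| ArcHub of a = 0%N & a' = 0%N & j = 0%N & 0 < j'
| ArcLow of a = 0%N & 0 < a' & j = 1%N & j' = 0%N
| ArcHigh of a = 0%N & 0 < a' & 1 < j & j' = (N + a')%N
| ArcStep of 0 < a & a = a' & j' = j.+1.

Lemma arcP a j a' j' : theta_arc a j a' j' -> arc_spec a j a' j'.
Proof.
case/or3P=> [/and4P[/eqP-> /eqP-> /eqP->]|/and4P[/eqP-> a0 j0]|].
- exact: ArcHub.
- case: (eqVneq j 1%N) => [->|j1] /eqP->; first exact: ArcLow.
  by apply: ArcHigh => //; lia.
by case/and3P=> a0 /eqP<- /eqP<-; exact: ArcStep.
Qed.

Lemma adjnP a j a' j' : theta_adjn a j a' j' ->
  theta_arc a j a' j' \/ theta_arc a' j' a j.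
Proof. by move/orP. Qed.

Lemma theta_bounds u :
  (strand u = 0%N /\ rank u <= 2) \/
  0 < strand u /\ strand u <= m.+2 /\ rank u <= N + strand u.
Proof.
move: (theta_okP u); rewrite /theta_ok; case: eqVneq => [->|u0] /andP[um uN].
  by left.
by right; lia.
Qed.

Lemma theta_clique_links : clique_links theta.
Proof.
move=> x y u v xy /setIP[+ +] /setIP[].
rewrite !in_link !theta_adjE => xu yu xv yv.
case/eqP; move: xy; rewrite theta_eqP negb_and => /orP xy.
have {xy} : strand x <> strand y \/ rank x <> rank y.
  by case: xy => /eqP ?; [left|right].
move=> xy; suff : ~ (strand u <> strand v \/ rank u <> rank v).
  by move=> H; apply: theta_inj; lia.
have := (theta_bounds x, theta_bounds y, theta_bounds u, theta_bounds v).
move: xy xu yu xv yv.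
move: (strand x) (strand y) (strand u) (strand v).
move: (rank x) (rank y) (rank u) (rank v) => x' y' u' v' X Y U V.
move=> xy xu yu xv yv [[[bx by'] bu] bv] uv.
case/adjnP: xu => /arcP; case=> *; case/adjnP: yu => /arcP; case=> *; subst;
  try (clear xv yv; lia).
all: try (case/adjnP: xv => /arcP xv; case: xv => *; subst; try (clear yv; lia)).
all: try (case/adjnP: yv => /arcP yv; case: yv => *; subst; try lia).
Qed.

Lemma theta_good : good theta.
Proof. by split; [exact: theta_branching|exact: theta_clique_links]. Qed.

(** The propositional form of [theta_arc], suited to linear arithmetic. *)
Definition arcp (a j a' j' : nat) : Prop :=
  (a = 0 /\ a' = 0 /\ j = 0 /\ 0 < j' \/ a = 0 /\ 0 < a' /\ j = 1 /\ j' = 0 \/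
   a = 0 /\ 0 < a' /\ 1 < j /\ j' = N + a' \/ 0 < a /\ a = a' /\ j' = j.+1)%N.

Lemma arcpE a j a' j' : theta_arc a j a' j' <-> arcp a j a' j'.
Proof.
split=> [/arcP[]|]; rewrite /arcp; try lia.
rewrite /theta_arc; case=> [[-> [-> [-> j0]]]|]; first by rewrite j0.
case=> [[-> [a0 [-> ->]]]|]; first by rewrite a0 orbT.
case=> [[-> [a0 [j1 ->]]]|[a0 [<- ->]]]; last by rewrite a0 !eqxx !orbT.
by rewrite a0 (gtn_eqF j1) !eqxx (ltnW j1) orbT.
Qed.

Lemma theta_adjP u v : reflect
  (arcp (strand u) (rank u) (strand v) (rank v) \/
   arcp (strand v) (rank v) (strand u) (rank u)) (adj u v).
Proof.
apply: (iffP idP) => [/adjnP[]/arcpE ?|]; [by left|by right|].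
by case=> /arcpE uv; rewrite theta_adjE /theta_adjn uv ?orbT.
Qed.

Section Piece.
Variable i : nat.
Hypothesis im : 0 < i <= m.+2.

(** The cycle formed by the hub, the two ends and one strand. *)
Definition piece : {set T} :=
  [set u | (strand u == 0%N) || (strand u == i)].

Lemma in_piece u : u \in piece = (strand u == 0%N) || (strand u == i).
Proof. by rewrite inE. Qed.

(* the length of the cycle *)
Let n := (N + i + 4)%N.

(** Positions along the cycle run from 0 to [n + n], that is, twice around it, so
    that every arc of the cycle is an interval of positions. *)
Definition at_pos u (k : nat) : Prop :=
  (strand u = 0 /\ rank u = 0 /\ (k = 0 \/ k = n) \/
   strand u = 0 /\ rank u = 1 /\ (k = 1 \/ k = n.+1) \/
   strand u = 0 /\ rank u = 2 /\ (k.+1 = n \/ k.+1 = n + n) \/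
   strand u = i /\ (k = (rank u).+2 \/ k = (rank u).+2 + n))%N.

Lemma at_ex k : k < n + n -> exists u, at_pos u k.
Proof.
have mk a j : theta_ok a j -> exists u, strand u = a /\ rank u = j.
  exact: theta_ex.
have [u0 [a0 j0]] := mk 0%N 0%N isT.
have [u1 [a1 j1]] := mk 0%N 1%N isT.
have [u2 [a2 j2]] := mk 0%N 2%N isT.
move=> kn; case: (pselect (k = 0 \/ k = n)%N) => [k0|k0].
  by exists u0; rewrite /at_pos; lia.
case: (pselect (k = 1 \/ k = n.+1)%N) => [k1|k1].
  by exists u1; rewrite /at_pos; lia.
case: (pselect (k.+1 = n \/ k.+1 = n + n)%N) => [k2|k2].
  by exists u2; rewrite /at_pos; lia.
pose j := (if k < n then k - 2 else k - n - 2)%N.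
have ok : theta_ok i j.
  rewrite /theta_ok; have -> : (i == 0%N) = false by lia.
  by rewrite /j; move: kn k0 k1 k2; rewrite /n; case: ifP; lia.
have [u [a jj]] := mk i j ok; exists u; rewrite /at_pos a jj /j.
by move: kn k0 k1 k2; rewrite /n; case: ifP; lia.
Qed.

Lemma at_piece u k : at_pos u k -> u \in piece.
Proof. by rewrite in_piece /at_pos; lia. Qed.

Lemma at_fun u v k : at_pos u k -> at_pos v k -> u = v.
Proof.
move=> uk vk; suff [] : strand u = strand v /\ rank u = rank v.
  exact: theta_inj.
move: uk vk (theta_bounds u) (theta_bounds v); rewrite /at_pos /n.
move: (strand u) (strand v) (rank u) (rank v) => a b c d.
by lia.
Qed.

Lemma at_adj u v k : at_pos u k -> at_pos v k.+1 -> adj u v.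
Proof.
move=> uk vk; apply/theta_adjP.
move: uk vk (theta_bounds u) (theta_bounds v); rewrite /at_pos /n /arcp.
move: (strand u) (strand v) (rank u) (rank v) => a b c d.
case=> [[-> [-> uk]]|[[-> [-> uk]]|[[-> [-> uk]]|[-> uk]]]];
  case=> [[-> [-> vk]]|[[-> [-> vk]]|[[-> [-> vk]]|[-> vk]]]];
  move=> ub vb; try (exfalso; lia).
- by left; left; lia.
- by left; right; left; lia.
- by right; left; lia.
- by right; right; right; left; lia.
by left; right; right; right; lia.
Qed.

Lemma at_exists u : u \in piece ->
  exists k, k < n /\ at_pos u k /\ at_pos u (k + n).
Proof.
rewrite in_piece => up; have := theta_bounds u.
pose k := if strand u == 0%N then (if rank u == 2 then n.-1 else rank u)
  else (rank u).+2.
exists k; move: up; rewrite /at_pos /k /n.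
by case: ifP => [|_]; [case: ifP|]; lia.
Qed.

Lemma at_star z u t k : t < n -> at_pos z t -> at_pos u k -> u \in star z ->
  (k = t \/ k = t + n \/ k = t.+1 \/ k.+1 = t \/ k = t.+1 + n \/
   k.+1 = t + n \/ k.+1 = t + (n + n) \/ k + n = t.+1)%N.
Proof.
move=> tn zt uk; rewrite in_star => /orP[/eqP uz|/theta_adjP zu].
  move: tn uk zt (theta_bounds u); rewrite -uz /at_pos /n => tn.
  move: (strand u) (rank u) => a b.
  case=> [[-> [-> uk]]|[[-> [-> uk]]|[[-> [-> uk]]|[-> uk]]]] zt; lia.
move: tn zt uk zu (theta_bounds u) (theta_bounds z); rewrite /at_pos /n /arcp.
move: (strand u) (strand z) (rank u) (rank z) => a b c d tn.
case=> [[-> [-> uk]]|[[-> [-> uk]]|[[-> [-> uk]]|[-> uk]]]];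
  case=> [[-> [-> vk]]|[[-> [-> vk]]|[[-> [-> vk]]|[-> vk]]]];
  case=> -[?|[?|[?|?]]] ub vb; lia.
Qed.

Lemma notin_piece_star z u : z \notin piece -> u \in piece ->
  u \in star z -> strand u = 0%N /\
  (rank u = 1 /\ rank z = 0 \/ rank u = 2 /\ rank z = N + strand z)%N.
Proof.
move=> zp up; rewrite in_star => /orP[/eqP uz|/theta_adjP zu].
  by rewrite -uz up in zp.
move: zp up zu (theta_bounds u) (theta_bounds z); rewrite !in_piece /arcp.
move: (strand u) (strand z) (rank u) (rank z) => a b c d.
by move=> /norP[/eqP b0 /eqP bi] /orP[/eqP->|/eqP->];
  case=> -[?|[?|[?|?]]] ub vb; lia.
Qed.

(** Removing the star of any vertex of the graph from a piece leaves a path,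
    given by an interval of positions along the cycle. *)
Lemma piece_minus_star z : exists s l,
  [/\ 0 < l, s + l < n + n,
      forall u k, s <= k <= s + l -> at_pos u k -> u \notin star z
    & forall u, u \in piece -> u \notin star z ->
        exists2 k, s <= k <= s + l & at_pos u k].
Proof.
have n5 : 4 < n by rewrite /n; lia.
case: (boolP (z \in piece)) => zp.
  have [t [tn [zt zt']]] := at_exists zp.
  (* on the cycle, the star of [z] is [z] with its two neighbours *)
  exists (t.+2), (n - 4)%N; split; [lia|lia| |].
    move=> u k kt uk; apply/negP => /(at_star tn zt uk) H; lia.
  move=> u up nz; have [k [kn [uk uk']]] := at_exists up.
  have k1 : k != t.
    by apply: contraNneq nz => kt; rewrite -kt in zt;
      rewrite (at_fun uk zt) star_self.
  have k2 : k != t.+1.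
    apply: contraNneq nz => kt; rewrite in_star (at_adj zt) ?orbT //.
    by rewrite -kt.
  have k3 : k.+1 != t.
    apply: contraNneq nz => kt; rewrite in_star adj_sym (at_adj uk) ?orbT //.
    by rewrite kt.
  have k4 : k.+1 != (t + n)%N.
    apply: contraNneq nz => kt; rewrite in_star adj_sym (at_adj uk) ?orbT //.
    by rewrite kt.
  case: (leqP t.+2 k) => tk; first by exists k => //; lia.
  exists (k + n)%N => //; have k5 : (k + n)%N != t.+1.
    apply: contraNneq nz => kt; rewrite in_star (at_adj zt) ?orbT //.
    by rewrite -kt.
  by lia.
(* a vertex outside the cycle is adjacent to at most one of the ends *)
have pos u k : at_pos u k -> u \in star z ->
    (rank z = 0 /\ (k = 1 \/ k = n.+1) \/
     rank z = N + strand z /\ (k.+1 = n \/ k.+1 = n + n))%N.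
  move=> uk /(notin_piece_star zp (at_piece uk)); move: uk.
  by rewrite /at_pos; lia.
have z0 : (0 < strand z)%N by move: zp; rewrite in_piece; lia.
have pos' u : u \in piece -> u \notin star z ->
    exists k, [/\ k < n, at_pos u k, at_pos u (k + n),
      rank z = 0 -> k <> 1 & (rank z = N + strand z -> k.+1 <> n)]%N.
  move=> up nz; have [k [kn [uk uk']]] := at_exists up; exists k; split=> //.
    move=> zr k1; case/negP: nz; rewrite in_star; apply/orP; right.
    have [u0 u1] : (strand u = 0 /\ rank u = 1)%N.
      by move: uk (theta_bounds u); rewrite /at_pos /n; lia.
    by apply/theta_adjP; right; right; left; lia.
  move=> zN k1; case/negP: nz; rewrite in_star; apply/orP; right.
  have [u0 u2] : (strand u = 0 /\ rank u = 2)%N.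
    by move: uk (theta_bounds u); rewrite /at_pos /n; lia.
  by apply/theta_adjP; right; right; right; left; lia.
case: (pselect (rank z = 0%N)) => [zr|zr].
  exists 2%N, (n - 2)%N; split; [lia|lia| |].
    by move=> u k kt uk; apply/negP => /(pos _ _ uk); lia.
  move=> u up /(pos' u up)[k [kn uk uk' k1 k2]].
  case: (posnP k) => k0; last by exists k => //; lia.
  by exists (k + n)%N => //; lia.
case: (pselect (rank z = N + strand z)%N) => [zN|zN].
  exists n, (n - 2)%N; split; [lia|lia| |].
    by move=> u k kt uk; apply/negP => /(pos _ _ uk); lia.
  move=> u up /(pos' u up)[k [kn uk uk' k1 k2]].
  by exists (k + n)%N => //; lia.
exists 0%N, (n - 1)%N; split; [lia|lia| |].
  by move=> u k kt uk; apply/negP => /(pos _ _ uk); lia.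
move=> u up /(pos' u up)[k [kn uk uk' k1 k2]].
by exists k => //; lia.
Qed.

Lemma piece_connected z (B : T -> Prop) :
  (forall u v, u \in piece :\: star z -> v \in piece :\: star z ->
     adj u v -> B u -> B v) ->
  forall u v, u \in piece :\: star z -> v \in piece :\: star z ->
    B u -> B v.
Proof.
have [s [l [l0 sl out ex]]] := piece_minus_star z => Badj.
have inR u k : s <= k <= s + l -> at_pos u k -> u \in piece :\: star z.
  by move=> ks uk; rewrite in_setD (out u k ks uk) (at_piece uk).
have up j k u v : s <= k -> k + j <= s + l -> at_pos u k -> at_pos v (k + j) ->
    B u -> B v.
  elim: j v => [|j IHj] v sk kl uk vk Bu.
    by rewrite addn0 in vk; rewrite -(at_fun uk vk).
  have [w wk] : exists w, at_pos w (k + j) by apply: at_ex; lia.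
  rewrite addnS in vk kl; apply: (Badj w v).
  - by apply: inR wk; lia.
  - by apply: inR vk; lia.
  - exact: at_adj wk vk.
  by apply: IHj => //; lia.
have down j k u v : s <= k -> k + j <= s + l -> at_pos u k -> at_pos v (k + j) ->
    B v -> B u.
  elim: j v => [|j IHj] v sk kl uk vk Bv.
    by rewrite addn0 in vk; rewrite (at_fun uk vk).
  have [w wk] : exists w, at_pos w (k + j) by apply: at_ex; lia.
  rewrite addnS in vk kl; apply: (IHj w) => //; first by lia.
  apply: (Badj v w).
  - by apply: inR vk; lia.
  - by apply: inR wk; lia.
  - by rewrite adj_sym; exact: at_adj wk vk.
  exact: Bv.
move=> u v; rewrite !in_setD => /andP[uz up'] /andP[vz vp].
have [[k ks uk] [k' ks' vk]] := (ex u up' uz, ex v vp vz).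
case: (leqP k k') => kk.
  by apply: (up (k' - k) k)%N; rewrite ?subnKC //; lia.
by apply: (down (k - k') k')%N; rewrite ?subnKC //; lia.
Qed.

Lemma piece_two z : 1 < #|piece :\: star z|.
Proof.
have [s [l [l0 sl out ex]]] := piece_minus_star z.
have [u us] : exists u, at_pos u s by apply: at_ex; lia.
have [v vs] : exists v, at_pos v s.+1 by apply: at_ex; lia.
have -> : 2 = #|[set u; v]| by rewrite cards2 (adj_neq (at_adj us vs)).
apply/subset_leq_card/subsetP => x; rewrite in_set2 => /orP[]/eqP->.
  by rewrite in_setD (out u s) ?(at_piece us) //; lia.
by rewrite in_setD (out v s.+1) ?(at_piece vs) //; lia.
Qed.

Lemma theta_triangle x y z : adj x y -> adj y z -> adj x z -> False.
Proof.
move=> /theta_adjP xy /theta_adjP yz /theta_adjP xz; move: xy yz xz.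
move: (theta_bounds x) (theta_bounds y) (theta_bounds z); rewrite /arcp.
move: (strand x) (strand y) (strand z) (rank x) (rank y) (rank z) => a b c d e f.
by move=> xb yb zb [[?|[?|[?|?]]]|[?|[?|[?|?]]]];
  case=> [[?|[?|[?|?]]]|[?|[?|[?|?]]]]; lia.
Qed.

(** One of the two neighbours of [v] on the cycle is not [z], and it is not
    adjacent to [z] because the graph has no triangle. *)
Lemma piece_escape z v : v \in piece -> v \in star z -> v != z ->
  exists u, [/\ u \in piece, adj v u & u \notin star z].
Proof.
move=> vp; rewrite in_star => /orP[/eqP->|zv vz]; first by rewrite eqxx.
have [k [kn [vk vk']]] := at_exists vp.
have [u uk] : exists u, at_pos u k.+1 by apply: at_ex; lia.
have [w wk] : exists w, at_pos w (k + n).-1 by apply: at_ex; rewrite /n; lia.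
have vu : adj v u by exact: at_adj vk uk.
have vw : adj v w.
  by rewrite adj_sym; apply: (at_adj wk); rewrite prednK //; rewrite /n; lia.
have uw : u != w.
  apply/eqP => uw; rewrite -uw in wk; move: uk wk kn (theta_bounds u).
  by rewrite /at_pos /n; move: (strand u) (rank u) => a b; lia.
have noz x : adj v x -> x != z -> x \notin star z.
  move=> vx xz; rewrite in_star (negbTE xz) /=; apply/negP => zx.
  exact: theta_triangle zv vx zx.
have [uz|uz] := eqVneq u z.
  exists w; split; [exact: at_piece wk|by []|apply: noz => //].
  by rewrite -uz eq_sym.
by exists u; split; [exact: at_piece uk|by []|exact: noz].
Qed.

End Piece.

Definition graph_automorphism (s s' : T -> T) :=
  [/\ cancel s s', cancel s' s & forall x y, adj (s x) (s y) = adj x y].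

Lemma graph_automorphism_sym s s' :
  graph_automorphism s s' -> graph_automorphism s' s.
Proof. by case=> sK sK' sadj; split=> // x y; rewrite -sadj !sK'. Qed.

(** Graph automorphisms fix the hub and preserve every strand: the two ends are
    the vertices of degree more than two, the hub is their only common neighbour,
    and strands have distinct lengths. *)
Definition is_end u := strand u = 0%N /\ 0 < rank u.

Lemma end_three_nbrs u : is_end u -> exists x y z,
  [/\ adj u x, adj u y & adj u z] /\ [/\ x != y, y != z & x != z].
Proof.
move=> [u0 u1].
have mk a j : theta_ok a j -> exists v, strand v = a /\ rank v = j by exact: theta_ex.
pose e a := if rank u == 1%N then 0%N else (N + a)%N.
have ok a : 0 < a <= m.+2 -> theta_ok a (e a).
  move=> /andP[a0 am]; rewrite /theta_ok am (gtn_eqF a0) /e.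
  by case: (rank u == 1%N); rewrite /= ?leqnn.
have [x [x0 x1]] := mk 0%N 0%N isT.
have [y [y0 y1]] := mk _ _ (ok 1%N isT).
have [z [z0 z1]] := mk _ _ (ok 2%N isT).
exists x, y, z; split; split; rewrite ?theta_eqP ?x0 ?y0 ?z0 //.
- by apply/theta_adjP; right; left; lia.
- apply/theta_adjP; left; right; rewrite y0 y1 /e; case: eqVneq => u1'.
    by left; lia.
  by right; left; lia.
apply/theta_adjP; left; right; rewrite z0 z1 /e; case: eqVneq => u1'.
  by left; lia.
by right; left; lia.
Qed.

Lemma two_nbrs u x y z : ~ is_end u -> adj u x -> adj u y -> adj u z ->
  [\/ x = y, y = z | x = z].
Proof.
move=> nu; rewrite !theta_adjE => ux uy uz.
suff : [\/ strand x = strand y /\ rank x = rank y,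
  strand y = strand z /\ rank y = rank z | strand x = strand z /\ rank x = rank z].
  by case=> -[? ?]; [apply: Or31|apply: Or32|apply: Or33]; exact: theta_inj.
suff : ~ (~ (strand x = strand y /\ rank x = rank y) /\
  ~ (strand y = strand z /\ rank y = rank z) /\ ~ (strand x = strand z /\ rank x = rank z)).
  move=> H; case: (pselect (strand x = strand y /\ rank x = rank y)) => ?; first exact: Or31.
  case: (pselect (strand y = strand z /\ rank y = rank z)) => ?; first exact: Or32.
  by apply: Or33; apply: contrapT => ?; apply: H.
move: nu ux uy uz (theta_bounds u) (theta_bounds x) (theta_bounds y) (theta_bounds z).
rewrite /is_end.
move: (strand u) (strand x) (strand y) (strand z) (rank u) (rank x) (rank y) (rank z).
move=> a b c d a' b' c' d' nu ux uy uz ub xb yb zb neq.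
case/adjnP: ux => /arcP; case=> *; subst; try (clear uy uz; lia);
  case/adjnP: uy => /arcP; case=> *; subst; try (clear uz; lia);
  case/adjnP: uz => /arcP; case=> *; subst; lia.
Qed.

Lemma automorphism_end s s' u :
  graph_automorphism s s' -> is_end u -> is_end (s u).
Proof.
move=> [sK sK' sadj] /end_three_nbrs[x [y [z [[ux uy uz] [xy yz xz]]]]].
have sI := can_inj sK; apply: contrapT => nu.
rewrite -(inj_eq sI) in xy; rewrite -(inj_eq sI) in yz.
rewrite -(inj_eq sI) in xz; rewrite -sadj in ux; rewrite -sadj in uy.
rewrite -sadj in uz.
have [/eqP|/eqP|/eqP] := two_nbrs nu ux uy uz.
- by rewrite (negbTE xy).
- by rewrite (negbTE yz).
by rewrite (negbTE xz).
Qed.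

Definition is_hub u := strand u = 0%N /\ rank u = 0%N.

Lemma hub_nbrs u x y : is_end x -> is_end y -> x != y -> adj u x -> adj u y ->
  is_hub u.
Proof.
rewrite theta_eqP => -[x0 x1] [y0 y1]; rewrite x0 y0 eqxx /=.
move=> /eqP xy /theta_adjP + /theta_adjP.
move: x1 y1 xy (theta_bounds x) (theta_bounds y) (theta_bounds u).
rewrite /is_hub /arcp x0 y0.
move: (strand u) (rank x) (rank y) (rank u) => a b c d b0 c0 bc bx by' bu.
by case=> [[?|[?|[?|?]]]|[?|[?|[?|?]]]]; try lia;
  case=> [[?|[?|[?|?]]]|[?|[?|[?|?]]]]; lia.
Qed.

Lemma automorphism_hub s s' u : graph_automorphism s s' -> is_hub u -> s u = u.
Proof.
move=> ss' [u0 u1]; have [sK _ sadj] := ss'.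
have [x [x0 x1]] : exists v, strand v = 0%N /\ rank v = 1%N by exact: theta_ex.
have [y [y0 y1]] : exists v, strand v = 0%N /\ rank v = 2%N by exact: theta_ex.
have ux : adj u x by apply/theta_adjP; left; left; lia.
have uy : adj u y by apply/theta_adjP; left; left; lia.
have [xe ye] : is_end x /\ is_end y by rewrite /is_end; lia.
have [] : is_hub (s u); last by move=> a b; apply: theta_inj; rewrite ?a ?b.
apply: (@hub_nbrs _ (s x) (s y)); rewrite ?sadj //;
  try exact: (automorphism_end ss').
by rewrite (inj_eq (can_inj sK)) theta_eqP x0 x1 y0 y1.
Qed.

Lemma automorphism_strand_gt0 s s' u :
  graph_automorphism s s' -> 0 < strand u -> 0 < strand (s u).
Proof.
move=> ss' u0; have [sK sK' sadj] := ss'; rewrite lt0n; apply/eqP => su0.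
have ss := graph_automorphism_sym ss'.
case: (posnP (rank (s u))) => su1.
  have /(congr1 strand) : s' (s u) = s u.
    by apply: (automorphism_hub ss).
  by rewrite sK su0 => u0'; rewrite u0' in u0.
have [] : is_end (s' (s u)) by exact: (automorphism_end ss).
by rewrite sK => u0'; rewrite u0' in u0.
Qed.

Lemma strand_adj u v : 0 < strand u -> 0 < strand v -> adj u v ->
  strand u = strand v.
Proof. by move=> u0 v0 /theta_adjP; rewrite /arcp; lia. Qed.

Lemma automorphism_strand_eq s s' u v : graph_automorphism s s' ->
  0 < strand u -> strand u = strand v -> strand (s u) = strand (s v).
Proof.
move=> ss' u0 uv; have [_ _ sadj] := ss'.
suff base w : 0 < strand w -> forall w0, strand w0 = strand w -> rank w0 = 0%N ->
    strand (s w) = strand (s w0).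
  have [w0 [a0 j0]] : exists w0, strand w0 = strand u /\ rank w0 = 0%N.
    apply: theta_ex; rewrite /theta_ok (gtn_eqF u0).
    by case: (theta_bounds u); lia.
  by rewrite (base u u0 w0) // (base v _ w0) -?uv.
move rw: (rank w) => r w0p; elim: r w w0p rw => [|r IHr] w w0p rw x xw x0.
  by congr (strand (s _)); apply: theta_inj; rewrite ?xw ?x0.
have [y [ya yr]] : exists y, strand y = strand w /\ rank y = r.
  apply: theta_ex; rewrite /theta_ok (gtn_eqF w0p).
  by case: (theta_bounds w); lia.
rewrite -(IHr y _ yr x) ?ya //; apply: strand_adj.
- exact: (automorphism_strand_gt0 ss').
- by apply: (automorphism_strand_gt0 ss'); rewrite ya.
by rewrite sadj; apply/theta_adjP; right; right; right; right; lia.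
Qed.

(** An automorphism injects a strand into a strand, hence into one that is at
    least as long. *)
Lemma automorphism_strand_le s s' u : graph_automorphism s s' ->
  0 < strand u -> strand u <= strand (s u).
Proof.
move=> ss' u0; have [sK _ _] := ss'.
have [tv tvE] : exists tv : 'I_(N + strand u).+1 -> T,
    forall j, strand (tv j) = strand u /\ rank (tv j) = j.
  suff /choice[tv tvE] : forall j : 'I_(N + strand u).+1, exists v,
      strand v = strand u /\ rank v = j by exists tv.
  move=> j; apply: theta_ex; rewrite /theta_ok (gtn_eqF u0).
  apply/andP; split; last by rewrite -ltnS ltn_ord.
  by case: (theta_bounds u); lia.
have stv j : strand (s (tv j)) = strand (s u).
  by apply: (automorphism_strand_eq ss'); rewrite (tvE j).1.
have bound j : rank (s (tv j)) < (N + strand (s u)).+1.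
  have := theta_bounds (s (tv j)); rewrite stv.
  have := automorphism_strand_gt0 ss' u0; lia.
have /leq_card : injective (fun j => Ordinal (bound j)).
  move=> j k /(congr1 val) /= jk; apply: val_inj.
  have /(can_inj sK) tjk : s (tv j) = s (tv k) by apply: theta_inj; rewrite ?stv.
  by rewrite /= -(tvE j).2 -(tvE k).2 tjk.
by rewrite !card_ord; lia.
Qed.

Lemma automorphism_strand s s' u : graph_automorphism s s' ->
  strand (s u) = strand u.
Proof.
move=> ss'; have ss := graph_automorphism_sym ss'.
have [sK sK' _] := ss'; case: (posnP (strand u)) => u0.
  rewrite u0; apply/eqP; rewrite -leqn0 leqNgt; apply/negP => /(automorphism_strand_gt0 ss).
  by rewrite sK u0.
apply/eqP; rewrite eqn_leq (automorphism_strand_le ss' u0) andbT.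
have := automorphism_strand_le ss (automorphism_strand_gt0 ss' u0).
by rewrite sK.
Qed.

End Theta.

Lemma card_theta_lt m N N' : N < N' ->
  #|vertex (theta m N)| < #|vertex (theta m N')|.
Proof.
move=> NN; have /choice[f fE] : forall u : vertex (theta m N),
    exists v : vertex (theta m N'), strand v = strand u /\ rank v = rank u.
  move=> u; apply: theta_ex; have := theta_okP u; rewrite /theta_ok.
  by case: ifP => _; lia.
have fI : injective f.
  by move=> u v fuv; apply: theta_inj;
    rewrite -?(fE u).1 -?(fE v).1 -?(fE u).2 -?(fE v).2 fuv.
have [v [v1 vN]] : exists v : vertex (theta m N'),
    strand v = 1%N /\ rank v = N'.+1 by apply: theta_ex; rewrite /theta_ok /=; lia.
rewrite -(card_codom fI); apply: proper_card; apply/properP; split.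
  by apply/subsetP.
exists v => //; apply/negP => /codomP[u vu].
have := theta_bounds u; rewrite -(fE u).1 -(fE u).2 -vu v1 vN.
lia.
Qed.

(** * Integer powers *)

Section IntegerPowers.
Variable G : groupType.
Implicit Types (g h : G) (k l : int).

Definition zpow g k : G :=
  match k with Posz n => g ^+ n | Negz n => g ^- n.+1 end.

Lemma zpow0 g : zpow g 0 = 1. Proof. by []. Qed.

Lemma zpow1 g : zpow g 1 = g. Proof. exact: expg1. Qed.

Lemma zpowN1 g : zpow g (-1) = g^-1. Proof. by rewrite /= expg1. Qed.

Lemma zpowS g k : zpow g (k + 1)%R = zpow g k * g.
Proof.
case: k => [n|[|n]].
- by rewrite -PoszD addn1 /= expgSr.
- by rewrite /= expg1 mulVg.
have -> : (Negz n.+1 + 1)%R = Negz n by lia.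
by rewrite /= [g ^+ n.+2]expgS invgM mulgVK.
Qed.

Lemma zpowD g k l : zpow g (k + l)%R = zpow g k * zpow g l.
Proof.
have posD k' n : zpow g (k' + Posz n)%R = zpow g k' * zpow g n.
  elim: n => [|n IHn]; first by rewrite GRing.addr0 mulg1.
  have -> : (k' + n.+1%:Z = (k' + n%:Z) + 1)%R by lia.
  by rewrite zpowS IHn -mulgA -zpowS; congr (_ * zpow _ _); lia.
case: l => [n|n]; first exact: posD.
apply: (@mulIg _ (zpow g (Posz n.+1))); rewrite -posD -mulgA -posD.
have -> : (Negz n + n.+1%:Z = 0)%R by lia.
by rewrite mulg1; congr (zpow g _); lia.
Qed.

Lemma zpowN g k : zpow g (- k)%R = (zpow g k)^-1.
Proof.
by apply/esym/mulg1_eq; rewrite -zpowD GRing.subrr.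
Qed.

Lemma zpowM g k l : zpow (zpow g k) l = zpow g (k * l)%R.
Proof.
have pos n : zpow g k ^+ n = zpow g (k * n%:Z)%R.
  elim: n => [|n IHn]; first by rewrite GRing.mulr0.
  by rewrite expgSr IHn -zpowD; congr (zpow g _); lia.
case: l => n /=; first exact: pos.
by rewrite pos -zpowN; congr (zpow g _); lia.
Qed.

Lemma commute_zpow g h k : commute h g -> commute h (zpow g k).
Proof.
by move=> hg; case: k => n /=; [exact: commuteX|apply/commuteV/commuteX].
Qed.

End IntegerPowers.

Lemma morph_zpow (G H : groupType) (f : G -> H) : {morph f : x y / x * y} ->
  forall g k, f (zpow g k) = zpow (f g) k.
Proof.
by move=> fM g [] n /=; rewrite ?(morphV fM) (morphX fM).
Qed.

Lemma expo_zpow (Gamma : sgraph) x (g : raag Gamma) k :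
  expo x (zpow g k) = (k * expo x g)%R.
Proof. by case: k => n /=; rewrite ?expoV expoX; lia. Qed.

Lemma sub1_zpow (Gamma : sgraph) x (g : raag Gamma) :
  in_sub [set x] g -> exists k, g = zpow (gen (x, true)) k.
Proof.
case=> w [+ <-]; elim: w => [_|a w IHw /= /andP[]]; first by exists 0%R.
rewrite inE => /eqP ax /IHw[k wk]; rewrite gprod_cons wk.
case: a ax => y [] /= ->.
  by exists (1 + k)%R; rewrite zpowD zpow1.
by exists (-1 + k)%R; rewrite zpowD zpowN1 gen_neg.
Qed.

(** * Automorphisms of the group of a theta graph *)

Section ThetaAutomorphisms.
Variables (m N : nat).
Local Notation T := (vertex (theta m N)).
Local Notation A := (raag (theta m N)).
Local Notation exponents := 'cV[int]_m.+1.
Implicit Types (u v x : T) (n : exponents) (g h : A).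

Fact hub_sig : {u : T | is_hub u}.
Proof. exact: cid (@theta_ex m N 0 0 isT). Qed.

Definition hub : T := sval hub_sig.

Lemma hubP : is_hub hub. Proof. exact: svalP hub_sig. Qed.

Local Notation c := (gen (hub, true) : A).

Lemma star_hub u : (u \in star hub) = (strand u == 0%N).
Proof.
have [h0 h1] := hubP; rewrite in_star theta_eqP h0 h1.
apply/orP/idP => [[/andP[//]|/theta_adjP]|/eqP u0].
  by rewrite /arcp h0 h1; lia.
case: (posnP (rank u)) => u1; first by left; rewrite u0 ?u1 !eqxx.
by right; apply/theta_adjP; left; left; lia.
Qed.

Lemma conj_hub_power u k : strand u = 0%N ->
  gen (u, true) ^ zpow c k = gen (u, true).
Proof.
move=> u0; have uc : commute (gen (u, true)) c.
  apply/commute_sym/(@sub_star_commute _ (hub, true)).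
  by apply: in_sub_gen; rewrite star_hub u0.
by rewrite conjgE (commute_zpow k uc) mulKg.
Qed.

(** The power of the hub that conjugates a vertex.  The star of the hub commutes
    with it; not moving the first strand makes shears unique modulo conjugation
    by the hub. *)
Definition exponent n u : int :=
  if 2 <= strand u then n (inord (strand u - 2)) ord0 else 0%R.

Lemma exponentE n u v : strand u = strand v -> exponent n u = exponent n v.
Proof. by rewrite /exponent => ->. Qed.

Lemma exponent0 n u : strand u <= 1 -> exponent n u = 0%R.
Proof. by rewrite /exponent leqNgt => /negbTE->. Qed.

Lemma exponentD n n' u : exponent (n + n')%R u = (exponent n u + exponent n' u)%R.
Proof. by rewrite /exponent; case: ifP; rewrite ?mxE. Qed.

Lemma exponentZ (e : int) n u : exponent (e *: n)%R u = (e * exponent n u)%R.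
Proof. by rewrite /exponent; case: ifP; rewrite ?mxE ?GRing.mulr0. Qed.

Definition shear_gen n u : A := gen (u, true) ^ zpow c (exponent n u).

Lemma shear_gen_commute n u v : adj u v -> commute (shear_gen n u) (shear_gen n v).
Proof.
move=> uv; suff [k [-> ->]] : exists k, shear_gen n u = gen (u, true) ^ zpow c k /\
    shear_gen n v = gen (v, true) ^ zpow c k.
  rewrite /commute -!conjMg; congr (_ ^ _); exact: gen_commute.
rewrite /shear_gen; case: (posnP (strand u)) => u0.
  by exists (exponent n v); rewrite !(conj_hub_power _ u0).
exists (exponent n u); split=> //; case: (posnP (strand v)) => v0.
  by rewrite !(conj_hub_power _ v0).
by rewrite (exponentE _ (strand_adj u0 v0 uv)).
Qed.

Definition shear n : A -> A := raag_lift (shear_gen n).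

Lemma shearM n : {morph shear n : x y / x * y}.
Proof. exact/raag_liftM/shear_gen_commute. Qed.

Lemma shearE n u e : shear n (gen (u, e)) = gen (u, e) ^ zpow c (exponent n u).
Proof.
rewrite /shear raag_lift_gen; last exact: shear_gen_commute.
by case: e => //=; rewrite /lift_letter /= gen_neg conjVg.
Qed.

Lemma shear_hub n : shear n c = c.
Proof. by rewrite shearE conj_hub_power //; case: hubP. Qed.

Lemma shear0 : shear 0%R =1 id.
Proof.
apply: eq_morph => //; first exact: shearM.
by move=> u; rewrite shearE /exponent !mxE if_same conjg1.
Qed.

Lemma shearD n n' : shear (n + n')%R =1 shear n \o shear n'.
Proof.
apply: eq_morph => [||u /=]; first exact: shearM.
  by move=> g h /=; rewrite !shearM.
rewrite !shearE (morphJ (@shearM n)) (morph_zpow (@shearM n)) shear_hub shearE.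
by rewrite -conjgM -zpowD exponentD.
Qed.

Lemma shear_automorphism n : is_automorphism (shear n).
Proof.
split; first exact: shearM.
exists (shear (- n)%R) => g.
  by have := shearD (- n)%R n g; rewrite GRing.addNr shear0 /= => <-.
by have := shearD n (- n)%R g; rewrite GRing.subrr shear0 /= => <-.
Qed.

Definition Shear n : aut_group A := mk_aut (shear_automorphism n).

Lemma ShearE n g : Shear n g = shear n g. Proof. by []. Qed.

Lemma ShearD n n' : Shear (n + n')%R = Shear n * Shear n'.
Proof. by apply: aut_ext => g; exact: shearD. Qed.

(** Up to inner automorphisms, these are a complement of the shears. *)
Definition signed (q : aut_group A) := exists a : T -> T * bool,
  [/\ forall u, q (gen (u, true)) = gen (a u), (a hub).1 = hub
    & forall u, strand (a u).1 = strand u].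

Lemma autM (q : aut_group A) : {morph q : x y / x * y}.
Proof. by case: (autP q). Qed.

Lemma aut_mulE (q q' : aut_group A) g : aut_fun (q * q') g = q (q' g).
Proof. by []. Qed.

Definition aut_sign (q : aut_group A) : int := expo hub (q c).

Lemma signed_letter (q : aut_group A) (a : T -> T * bool) u e :
  (forall u, q (gen (u, true)) = gen (a u)) ->
  q (gen (u, e)) = gen ((a u).1, e == (a u).2).
Proof.
move=> qa; case: e; first by rewrite qa; case: (a u) => v [].
rewrite gen_neg (morphV (@autM q)) qa; case: (a u) => v [] /=.
  by rewrite gen_neg.
by rewrite gen_neg invgK.
Qed.

Lemma signedM q q' : signed q -> signed q' -> signed (q * q').
Proof.
move=> [a [qa ah as_]] [b [qb bh bs]].
exists (fun u => ((a (b u).1).1, (b u).2 == (a (b u).1).2)); split.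
- by move=> u; rewrite aut_mulE qb [b u in LHS]surjective_pairing
    (signed_letter _ _ qa).
- by rewrite /= bh.
by move=> u; rewrite /= as_.
Qed.

Lemma signed_hub q : signed q -> q c = zpow c (aut_sign q) /\
  (aut_sign q = 1 \/ aut_sign q = -1)%R.
Proof.
case=> a [qa ah _]; rewrite /aut_sign qa expo_gen /letter_expo; move: ah.
case: (a hub) => v [] /= ->; rewrite eqxx.
  by rewrite zpow1; split => //; left.
by rewrite zpowN1 gen_neg; split => //; right.
Qed.

(** A signed automorphism preserves every strand and maps the hub to itself or to
    its inverse, so it acts on the shears by a scalar. *)
Lemma signed_shear q n : signed q ->
  q * Shear n = Shear (aut_sign q *: n)%R * q.
Proof.
move=> sq; have [qc _] := signed_hub sq; have [a [qa ah as_]] := sq.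
apply: aut_ext; apply: eq_morph; [exact: autM|exact: autM|move=> u].
rewrite !aut_mulE !ShearE.
rewrite qa shearE (morphJ (@autM q)) (morph_zpow (@autM q)) qa qc.
have := as_ u; case: (a u) => v e /= vu.
rewrite shearE exponentZ (exponentE _ vu); congr (_ ^ _).
by rewrite zpowM.
Qed.

End ThetaAutomorphisms.

Section Outer.
Variable G : groupType.

Lemma conj_automorphism (g : G) : is_automorphism (conjg^~ g).
Proof.
split; first by move=> x y; exact: conjMg.
by exists (conjg^~ g^-1) => x; [exact: conjgK|exact: conjgKV].
Qed.

Definition Conj (g : G) : aut_group G := mk_aut (conj_automorphism g).

Definition out (f : aut_group G) : out_group G := quot_pi (inn G) f.

Lemma outM : {morph out : f g / f * g}.
Proof. by move=> f g; exact: gmulfM. Qed.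

Lemma out1 f : out f = 1 <-> f \in @inner G.
Proof.
have -> : (1 : out_group G) = out 1 by rewrite (morph1 outM).
split => [/esym/quot_piP|fi]; first by rewrite invg1 mul1g.
by apply/esym/quot_piP; rewrite invg1 mul1g.
Qed.

Lemma out_surj h : exists f, out f = h.
Proof. exact: quot_pi_surj. Qed.

Lemma out_Conj g : out (Conj g) = 1.
Proof. by apply/out1/innerP; exists g. Qed.

Lemma out_eq f g : out f = out g -> exists a, forall x, g x = f x ^ a.
Proof.
move=> fg; have : out (g * f^-1) = 1 by rewrite outM (morphV outM) fg mulgV.
move/out1/innerP => [a fa]; exists a => x.
by rewrite -fa -[in LHS](mulgVK f g).
Qed.

End Outer.

Section ThetaStructure.
Variables (m N : nat).
Local Notation T := (vertex (theta m N)).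
Local Notation A := (raag (theta m N)).
Local Notation exponents := 'cV[int]_m.+1.
Local Notation c := (gen (hub m N, true) : A).
Implicit Types (u v x : T) (n : exponents) (g h : A) (q : aut_group A).

(** The hub is the only common vertex of the stars of the hub and of the two
    ends. *)
Lemma in_sub_hub g : (forall v, strand v = 0%N -> in_sub (star v) g) ->
  in_sub [set hub m N] g.
Proof.
move=> H; have [h0 h1] := hubP m N.
have [x [x0 x1]] : exists v : T, strand v = 0%N /\ rank v = 1%N.
  exact: (@theta_ex m N 0 1 isT).
have [y [y0 y1]] : exists v : T, strand v = 0%N /\ rank v = 2%N.
  exact: (@theta_ex m N 0 2 isT).
suff sub : star (hub m N) :&: (star x :&: star y) \subset [set hub m N].
  exact: in_subS sub (in_subI (H _ h0) (in_subI (H _ x0) (H _ y0))).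
apply/subsetP => u /setIP[]; rewrite star_hub => /eqP u0 /setIP[].
move=> ux uy; apply/set1P.
rewrite in_star theta_eqP in ux; rewrite in_star theta_eqP in uy.
apply: theta_inj; rewrite ?h0 ?h1 //.
rewrite u0 ?x0 ?x1 ?y0 ?y1 /= in ux uy.
have := theta_bounds u; rewrite u0.
case/orP: ux => [/eqP ux|/theta_adjP]; last by rewrite /arcp; lia.
case/orP: uy => [/eqP uy|/theta_adjP]; last by rewrite /arcp; lia.
by lia.
Qed.

Lemma common_coset (a : T -> T * bool) k s' (F : aut_group A) i :
  (forall x, F (gen (x, true)) = gen (a x) ^ k x) ->
  graph_automorphism (fun x => (a x).1) s' -> 0 < i <= m.+2 ->
  exists t, forall v, v \in piece m N i -> in_sub (star v) (k (s' v) * t).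
Proof.
move=> Fa [sK sK' sadj] im.
apply: (@cosets_common_point _ (piece m N i) (fun v => k (s' v))).
- move=> u v _ _ uv; rewrite /in_coset -{1}(sK' u) -{1}(sK' v).
  apply: (@commuting_cosets_meet _ (a (s' u)) (a (s' v))).
  rewrite -!Fa; apply: (morph_commute (@autM _ _ F)).
  apply: gen_commute; have := sadj (s' u) (s' v).
  by rewrite (sK' u) (sK' v) uv => <-.
- exact: piece_connected.
- exact: piece_two.
exact: piece_escape.
Qed.

Lemma conj_in_star u e g : in_sub (star u) g -> gen (u, e) ^ g = gen (u, e).
Proof.
move=> ug; rewrite conjgE (_ : gen (u, e) * g = g * gen (u, e)) ?mulKg //.
exact: (@sub_star_commute _ (u, e)).
Qed.

(** On the piece of each strand [i] the automorphism is, up to signs and a graph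
    automorphism, conjugation by the inverse of a common point [t i] of the cosets
    of conjugators.  Two of these points differ by an element of the stars of the
    hub and of the ends, that is, by a power of the hub, which gives the exponents
    of the shear relative to the first strand. *)
Theorem automorphism_decomposition (F : aut_group A) :
  exists n q, signed q /\ out F = out (Shear N n * q).
Proof.
have FK := aut_invK F; have FK' := aut_invVK F.
have [a [k [s' [Fa sK sK' sadj]]]] := iso_vertices (@autM _ _ F)
  (@autM _ _ (aut_inv F)) FK FK' (theta_good m N) (theta_good m N).
have ga : graph_automorphism (fun x => (a x).1) s' by [].
have /choice[t Ht] : forall i, exists t, 0 < i <= m.+2 ->
    forall v, v \in piece m N i -> in_sub (star v) (k (s' v) * t).
  move=> i; case: (boolP (0 < i <= m.+2)) => im; last by exists 1.
  by have [t Ht] := common_coset Fa ga im; exists t.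
have Fat i u : 0 < i <= m.+2 -> strand u = 0%N \/ strand u = i ->
    F (gen (u, true)) = gen (a u) ^ (t i)^-1.
  move=> im ui; rewrite Fa; have au := automorphism_strand u ga.
  have : (a u).1 \in piece m N i by rewrite in_piece au; lia.
  move/(Ht i im); rewrite sK => aut.
  have -> : k u = k u * t i * (t i)^-1 by rewrite mulgK.
  by rewrite conjgM; congr (_ ^ _); case: (a u) aut => v e; exact: conj_in_star.
have i1 : 0 < 1 <= m.+2 by [].
have /choice[e He] : forall i, exists e, 0 < i <= m.+2 ->
    (t i)^-1 = zpow c e * (t 1%N)^-1.
  move=> i; case: (boolP (0 < i <= m.+2)) => im; last by exists 0%R.
  have : in_sub [set hub m N] ((t i)^-1 * t 1%N).
    apply: in_sub_hub => v v0.
    have vi : v \in piece m N i by rewrite in_piece v0.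
    have v1 : v \in piece m N 1 by rewrite in_piece v0.
    have := in_subM (in_subV (Ht i im v vi)) (Ht 1%N i1 v v1).
    by rewrite invgM -!mulgA mulKg.
  by case/sub1_zpow => e' E; exists e' => _; rewrite -E mulgK.
pose n : exponents := (\col_j e j.+2)%R.
have ne u : 1 < strand u -> exponent n u = e (strand u).
  move=> u1; rewrite /exponent u1 mxE inordK; last first.
    by case: (theta_bounds u); lia.
  by congr (e _); lia.
pose C : aut_group A := Conj (t 1%N)^-1 * Shear N n.
have Cq : C * (C^-1 * F) = F by rewrite mulVKg.
exists n, (C^-1 * F); split; last first.
  have outC : out C = out (Shear N n) by rewrite /C outM out_Conj mul1g.
  by rewrite [RHS]outM -outC -outM Cq.
exists a; split; last by move=> u; exact: automorphism_strand u ga.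
  move=> u; have Cinj : injective C by case: (autP C) => _ /bij_inj.
  apply: Cinj; rewrite -[LHS]aut_mulE Cq /C aut_mulE ShearE.
  have -> : shear n (gen (a u)) = gen (a u) ^ zpow c (exponent n u).
    rewrite -(exponentE n (automorphism_strand u ga)).
    by case: (a u) => v b; rewrite shearE.
  have -> (x : A) : Conj (t 1%N)^-1 x = x ^ (t 1%N)^-1 by [].
  rewrite -conjgM; case: (leqP (strand u) 1) => u1.
    by rewrite exponent0 // zpow0 mul1g; apply: Fat => //; lia.
  have um : 0 < strand u <= m.+2 by case: (theta_bounds u); lia.
  by rewrite ne // -(He _ um); apply: Fat => //; right.
exact: (automorphism_hub ga (hubP m N)).
Qed.

Lemma hub_power_star u k : 0 < strand u -> in_sub (star u) (zpow c k) -> k = 0%R.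
Proof.
move=> u0 /retract_id; have hu : (hub m N \in star u) = false.
  by rewrite star_sym star_hub (gtn_eqF u0).
rewrite (morph_zpow (@retractM _ _)) retract_letter hu => /(congr1 (expo (hub m N))).
rewrite !expo_zpow expo1 expo_gen /letter_expo /= eqxx; lia.
Qed.

(** Exponent sums determine the signed part.  If two shears differ by conjugation
    by [g], then [g] centralizes the first piece, hence is trivial, and the
    exponents can be read off the first vertex of each strand. *)
Lemma decomposition_unique n n' q q' : signed q -> signed q' ->
  out (Shear N n * q) = out (Shear N n' * q') -> n = n' /\ q = q'.
Proof.
move=> [a [qa ah aS]] [a' [qa' ah' aS']] /out_eq[g Hg].
have sh n1 (b : T * bool) : exists k, shear n1 (gen b) = gen b ^ k.
  by case: b => v e; rewrite shearE; eexists.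
have qq : q = q'.
  apply: aut_ext; apply: eq_morph; [exact: autM|exact: autM|move=> u].
  have := Hg (gen (u, true)); rewrite !aut_mulE !ShearE qa qa'.
  have [[k1 ->] [k2 ->]] := (sh n (a u), sh n' (a' u)).
  by rewrite -conjgM => /conj_gen_inj ->.
split=> //; rewrite -{}qq in Hg.
have {}Hg u : gen (u, true) ^ zpow c (exponent n' u) =
    gen (u, true) ^ (zpow c (exponent n u) * g).
  have := Hg (aut_inv q (gen (u, true))); rewrite !aut_mulE !ShearE.
  by rewrite !aut_invVK !shearE conjgM.
have cent u (k : A) : gen (u, true) ^ k = gen (u, true) -> in_sub (star u) k.
  move=> uk; apply: (@centralizer_gen _ (u, true)).
  by rewrite /commute conjgC uk.
have fixed u : strand u <= 1 -> in_sub (star u) g.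
  by move=> u1; apply: cent; have := Hg u; rewrite !exponent0 // zpow0 conjg1 mul1g.
have [w [w1 w0]] : exists v : T, strand v = 1%N /\ rank v = 0%N.
  exact: (@theta_ex m N 1 0 isT).
have g1 : g = 1.
  have [k gk] : exists k, g = zpow c k.
    by apply/sub1_zpow/in_sub_hub => v v0; apply: fixed; rewrite v0.
  have := fixed w; rewrite w1 gk => /(_ isT) /hub_power_star.
  by rewrite w1 => ->.
apply/matrixP => j j0; rewrite (ord1 j0).
have [u [u1 u0]] : exists v : T, strand v = j.+2 /\ rank v = 0%N.
  by apply: theta_ex; rewrite /theta_ok /= ltnS ltn_ord.
have nj n1 : n1 j ord0 = exponent n1 u.
  by rewrite /exponent u1 /= subn2 /= inord_val.
rewrite !nj; suff : (exponent n' u - exponent n u = 0)%R by lia.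
apply: (@hub_power_star u); first by rewrite u1.
apply: cent; rewrite zpowD conjgM Hg g1 mulg1 -conjgM -zpowD.
by rewrite GRing.subrr zpow0 conjg1.
Qed.

End ThetaStructure.

(** * Linear groups acting on the outer automorphism group *)

Section Embeddings.
Variables (G H : groupType).

Definition packed (f : G -> H) (fM : {morph f : x y / x * y}) : G -> H := f.
HB.instance Definition _ f fM :=
  isMultiplicative.Build G H (@packed f fM) fM.

Lemma embeds_morph (f : G -> H) :
  {morph f : x y / x * y} -> injective f -> embeds G H.
Proof. by move=> fM fI; exists (packed fM : {multiplicative G -> H}). Qed.

End Embeddings.

Lemma embeds_quotient (G H : groupType) (N : normal_subgroup G) (f : G -> H) :
  {morph f : x y / x * y} -> (forall x, f x = 1 <-> x \in N) ->
  embeds (quot_group N) H.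
Proof.
move=> fM fN; have fpi x y : quot_pi N x = quot_pi N y <-> f x = f y.
  rewrite quot_piP -fN fM (morphV fM); split=> [/mulg1_eq|->].
    by rewrite invgK.
  by rewrite mulVg.
apply: (embeds_morph (f := fun a : quot_group N => f (repr a))).
  move=> a b; rewrite -fM; apply/fpi.
  by rewrite -quot_mul_pi !quot_repr.
by move=> a b /fpi; rewrite !quot_repr.
Qed.

Section Action.
Variables (m N : nat).
Local Notation A := (raag (theta m N)).
Local Notation exponents := 'cV[int]_m.+1.
Local Notation c := (gen (hub m N, true) : A).
Implicit Types (n : exponents) (M : 'M[int]_m.+1) (q : aut_group A).
Implicit Types (h : out_group A).

Fact decomposition_sig h : {p : exponents * aut_group A |
  signed p.2 /\ h = out (Shear N p.1 * p.2)}.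
Proof.
apply: cid; have [F <-] := out_surj h.
by have [n [q [sq E]]] := automorphism_decomposition F; exists (n, q).
Qed.

Definition exponents_of h := (sval (decomposition_sig h)).1.
Definition signed_of h := (sval (decomposition_sig h)).2.

Lemma decompositionP h :
  signed (signed_of h) /\ h = out (Shear N (exponents_of h) * signed_of h).
Proof. exact: svalP (decomposition_sig h). Qed.

(** A matrix acts on the shear part only.  It is compatible with products because
    signed automorphisms act on exponents by scalars. *)
Definition linear_action M h : out_group A :=
  out (Shear N (M *m exponents_of h)%R * signed_of h).

Lemma linear_actionE M n q : signed q ->
  linear_action M (out (Shear N n * q)) = out (Shear N (M *m n)%R * q).
Proof.
move=> sq; have [sq' E] := decompositionP (out (Shear N n * q)).
by rewrite /linear_action; have [<- <-] := decomposition_unique sq sq' E.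
Qed.

Lemma out_shear_mul n n' q q' : signed q ->
  out (Shear N n * q) * out (Shear N n' * q') =
  out (Shear N (n + aut_sign q *: n')%R * (q * q')).
Proof.
move=> sq; rewrite -outM; congr out.
by rewrite ShearD -!mulgA; congr (_ * _); rewrite !mulgA -signed_shear.
Qed.

Lemma linear_actionM M : {morph linear_action M : h k / h * k}.
Proof.
move=> h k; have [[sh ->] [sk ->]] := (decompositionP h, decompositionP k).
rewrite out_shear_mul // !linear_actionE //; last exact: signedM.
by rewrite out_shear_mul // mulmxDr -scalemxAr.
Qed.

Lemma linear_action_comp M M' h :
  linear_action (M *m M')%R h = linear_action M (linear_action M' h).
Proof.
have [sh ->] := decompositionP h.
by rewrite !linear_actionE // mulmxA.
Qed.

Lemma linear_action1 h : linear_action 1%:M%R h = h.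
Proof. by have [sh ->] := decompositionP h; rewrite linear_actionE // mul1mx. Qed.

Lemma linear_action_automorphism (x : GLZ m) :
  is_automorphism (linear_action (val x)).
Proof.
split; first exact: linear_actionM.
have xV : (val x *m val (x^-1)%g = 1%:M)%R by exact: (congr1 val (mulgV x)).
have Vx : (val (x^-1)%g *m val x = 1%:M)%R by exact: (congr1 val (mulVg x)).
by exists (linear_action (val x^-1)) => h;
  rewrite -linear_action_comp ?xV ?Vx linear_action1.
Qed.

Definition Action (x : GLZ m) : aut_group (out_group A) :=
  mk_aut (linear_action_automorphism x).

Lemma ActionM : {morph Action : x y / x * y}.
Proof. by move=> x y; apply: aut_ext => h; exact: linear_action_comp. Qed.

Lemma signed1 : signed (1 : aut_group A).
Proof. by exists (fun u => (u, true)). Qed.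

Lemma mulmx_col_inj M M' :
  (forall n, (M *m n = M' *m n)%R) -> M = M'.
Proof.
move=> MM; apply/matrixP => i j.
have := MM (delta_mx j 0%R); rewrite -!colE => /matrixP/(_ i 0%R).
by rewrite !mxE.
Qed.

Lemma Action_inj : injective Action.
Proof.
move=> x y xy; apply: val_inj; apply: mulmx_col_inj => n.
have : linear_action (val x) (out (Shear N n * 1)) =
    linear_action (val y) (out (Shear N n * 1)).
  by have := congr1 (fun f : aut_group _ => f (out (Shear N n * 1))) xy.
rewrite !linear_actionE; try exact: signed1.
by case/(decomposition_unique signed1 signed1).
Qed.

Section SignChange.
Variable sg : vertex (theta m N) -> bool.

Definition sign_gen u : A := gen (u, sg u).
Definition sign_change : A -> A := raag_lift sign_gen.

Lemma sign_gen_commute u v : adj u v -> commute (sign_gen u) (sign_gen v).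
Proof. by move=> uv; exact: gen_commute. Qed.

Lemma sign_changeM : {morph sign_change : x y / x * y}.
Proof. exact/raag_liftM/sign_gen_commute. Qed.

Lemma sign_changeE u e : sign_change (gen (u, e)) = gen (u, e == sg u).
Proof.
rewrite /sign_change raag_lift_gen; last exact: sign_gen_commute.
by case: e => //; rewrite /lift_letter /sign_gen -gen_inv.
Qed.

Lemma sign_change_automorphism : is_automorphism sign_change.
Proof.
split; first exact: sign_changeM.
have invK : cancel sign_change sign_change.
  apply: (@eq_morph _ _ (sign_change \o sign_change) id) => //.
    by move=> x y; rewrite /comp !sign_changeM.
  by move=> u; rewrite /comp !sign_changeE; case: (sg u).
by exists sign_change.
Qed.

Definition SignChange : aut_group A := mk_aut sign_change_automorphism.

Lemma SignChangeE u e : SignChange (gen (u, e)) = gen (u, e == sg u).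
Proof. exact: sign_changeE. Qed.

Lemma signed_SignChange : signed SignChange.
Proof. by exists (fun u => (u, sg u)); split=> // u; exact: SignChangeE. Qed.

End SignChange.

Definition Inversion := SignChange (fun u => u != hub m N).

Lemma signed_inversion : signed Inversion.
Proof. exact: signed_SignChange. Qed.

Lemma sign_inversion : aut_sign Inversion = (-1)%R.
Proof.
by rewrite /aut_sign SignChangeE eqxx expo_gen /letter_expo eqxx.
Qed.

Lemma inversion_central q : signed q -> Inversion * q = q * Inversion.
Proof.
move=> [a [qa ah aS]]; have aI : injective (fun u => (a u).1).
  move=> u v uv; have [qM /bij_inj qI] := autP q.
  pose e := (a v).2 == (a u).2.
  have /qI/(congr1 (expo u)) : q (gen (u, true)) = q (gen (v, e)).
    rewrite (signed_letter v e qa) qa -uv /e; case: (a u) (a v) => [? []] [? []] //.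
  rewrite !expo_gen /letter_expo /= eqxx; case: eqVneq => [->//|_]; lia.
apply: aut_ext; apply: eq_morph; [exact: autM|exact: autM|move=> u].
rewrite !aut_mulE qa.
rewrite SignChangeE (signed_letter _ _ qa) [a u in LHS]surjective_pairing.
rewrite SignChangeE.
have -> : ((a u).1 != hub m N) = (u != hub m N) by rewrite -{1}ah (inj_eq aI).
by case: (u != _); case: (a u).2.
Qed.

(** If the action of [x] is conjugation by the class of a shear times [q0],
    comparing both on the shears shows that [x] is the scalar matrix given by the
    sign of [q0].  Conversely -1 acts as conjugation by the inversion of the
    hub. *)
Lemma inner_Action (x : GLZ m) :
  Action x \in @inner (out_group A) <-> x \in pm1 (R := 'M[int]_m.+1).
Proof.
have -> : (x \in pm1 (R := 'M[int]_m.+1)) = (val x == 1%R) || (val x == (-1)%R) by [].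
split=> [/innerP[a xa]|].
  have [n0 [q0 [sq0 aE]]] : exists n0 q0, signed q0 /\ a = out (Shear N n0 * q0).
    by have [? ?] := decompositionP a; exists (exponents_of a), (signed_of a).
  have xE n : n = (aut_sign q0 *: (val x *m n))%R.
    have Ex : linear_action (val x) (out (Shear N n * 1)) = out (Shear N n * 1) ^ a.
      exact: xa.
    rewrite linear_actionE in Ex; last exact: signed1.
    have : a * out (Shear N (val x *m n)%R * 1) = out (Shear N n * 1) * a.
      by rewrite Ex -conjgC.
    rewrite aE.
    rewrite !out_shear_mul ?mul1g ?mulg1 //; last exact: signed1.
    case/(decomposition_unique sq0 sq0) => + _.
    have -> : aut_sign (1 : aut_group A) = 1%R.
      by rewrite /aut_sign expo_gen /letter_expo /= eqxx.
    rewrite GRing.scale1r [(n + n0)%R]GRing.addrC => /GRing.addrI E.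
    exact/esym.
  have [_ [s1|s1]] := signed_hub sq0; rewrite s1 in xE.
    apply/orP; left; apply/eqP; apply: mulmx_col_inj => n.
    by rewrite mul1mx [RHS]xE GRing.scale1r.
  apply/orP; right; apply/eqP; apply: mulmx_col_inj => n.
  by rewrite mulNmx mul1mx [in RHS](xE n) GRing.scaleN1r GRing.opprK.
case/orP=> /eqP x1; apply/innerP.
  exists 1 => h; rewrite conjg1 -[LHS]/(linear_action _ _) x1.
  exact: linear_action1.
exists (out Inversion) => h; rewrite -[LHS]/(linear_action _ _) x1.
apply: (@mulgI _ (out Inversion)); rewrite -conjgC.
have [sh ->] := decompositionP h; rewrite linear_actionE //.
have IE : out Inversion = out (Shear N 0%R * Inversion).
  congr out; rewrite -[LHS]mul1g; congr (_ * _).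
  by apply: aut_ext => g; rewrite ShearE shear0.
have si := signed_inversion.
rewrite IE !out_shear_mul // sign_inversion inversion_central //.
congr (out (Shear N _ * _)).
by rewrite GRing.add0r mulNmx mul1mx GRing.scaleN1r GRing.opprK GRing.scaler0 GRing.addr0.
Qed.

End Action.

Theorem corollary3p5 :
  (forall G : groupType, Z_linear G ->
     infinitely_many_raags
       (fun Gamma => embeds G (aut_group (out_group (raag Gamma))))) /\
  (forall G : groupType, projective_Z_linear G ->
     infinitely_many_raags
       (fun Gamma => embeds G (out_group (out_group (raag Gamma))))).
Proof.
have many m : forall i j : nat, i != j ->
    ~ isomorphic (raag (theta m i)) (raag (theta m j)).
  move=> i j ij /(raag_iso_card (theta_good m i) (theta_good m j)) card.
  by case: (ltngtP i j) ij => // /(card_theta_lt m); rewrite card ltnn.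
split=> G [m [S [_ [f fI _]]]]; exists (theta m);
  (split; [exact: many|move=> N]).
  apply: (embeds_morph (f := fun g => Action N (f g))).
    by move=> x y; rewrite gmulfM ActionM.
  by move=> x y /Action_inj/fI.
pose F (x : GLZ m) := out (Action N x).
have FM : {morph F : x y / x * y} by move=> x y; rewrite /F ActionM outM.
have FN x : F x = 1 <-> x \in pm1_normal 'M[int]_m.+1.
  by apply: (iff_trans (out1 _)); exact: inner_Action.
have [e eI] := embeds_quotient FM FN.
by exists (e \o f); exact: inj_comp.
Qed.
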